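(* Let $\mathcal{H}$ be a Hilbert space of finite dimension $N\geqslant1$. For any $(u,\varphi),(v,\psi)\in\widetilde{\mathrm{U}}(\mathcal{H})$, one has $$\tilde d\bigl((u,\varphi),(v,\psi)\bigr)=m,$$ where $m=\min\bigl\{\max_{i=1,\dots,N}|\theta_i|:\theta\in R\bigr\}$ and $$R=\Bigl\{\theta\in\mathbb{R}^N:\ e^{i\theta_i}=\lambda_i\ \forall i,\ \text{ and }\ \sum_{i=1}^N\theta_i=\psi-\varphi\Bigr\},$$ $\lambda_1,\dots,\lambda_N$ being the eigenvalues (with multiplicity) of $vu^{-1}$.
   Context: $\mathrm{U}(\mathcal{H})$ is the unitary group and $\|\cdot\|$ the operator norm. The universal cover is realised as $\widetilde{\mathrm{U}}(\mathcal{H})=\{(u,\varphi)\in\mathrm{U}(\mathcal{H})\times\mathbb{R}:\det u=e^{i\varphi}\}$. The length of a piecewise $C^1$ curve $(\gamma(t),\varphi(t))$, $t\in[a,b]$, in $\widetilde{\mathrm{U}}(\mathcal{H})$ is $\int_a^b\|\gamma'(t)\|\,dt$, and $\tilde d(\tilde u,\tilde v)$ is the infimum of the lengths of curves joining $\tilde u$ to $\tilde v$. *)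

(* Defs.v *)
From HB Require Import structures.
From mathcomp Require Import all_boot all_order all_algebra.
From mathcomp Require Import sesquilinear.
From mathcomp Require Import all_classical all_reals all_analysis.
From mathcomp Require Import complex.

Set Implicit Arguments.
Unset Strict Implicit.
Unset Printing Implicit Defensive.

Import Order.TTheory GRing.Theory Num.Theory Num.Def.
Import numFieldNormedType.Exports.

Local Open Scope classical_set_scope.
Local Open Scope complex_scope.
Local Open Scope ring_scope.

(** A finite-dimensional complex Hilbert space is a [vectType] over [R[i]]
    together with a positive definite Hermitian form (linear in the first
    argument); completeness is automatic. *)

Definition expi (R : realType) (x : R) : R[i] := cos x +i* sin x.

Section Endomorphisms.
Context (R : realType) (H : vectType R[i]).

(* The basis is immaterial: determinant and characteristic polynomial are
   invariant under conjugation (and transposition, [passmx.mxof] acting on rows). *)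
Definition endo_mx (f : 'End(H)) : 'M[R[i]]_(\dim {:H}) :=
  passmx.mxof (vbasis {:H}) (vbasis {:H}) f.

Definition endo_det (f : 'End(H)) : R[i] := \det (endo_mx f).

Definition endo_char_poly (f : 'End(H)) : {poly R[i]} :=
  char_poly (endo_mx f).

End Endomorphisms.

Section UniversalCover.
Context (R : realType) (H : vectType R[i]) (form : {dot H for conjC}).

Definition hnorm (x : H) : R := Num.sqrt (complex.Re (form x x)).

Definition opnorm (f : 'End(H)) : R :=
  sup [set hnorm (f x) | x in [set x | hnorm x <= 1]].

Definition unitary (u : 'End(H)) : Prop :=
  bijective u /\ forall x y, form (u x) (u y) = form x y.

Definition unitary_cover : set ('End(H) * R) :=
  [set p | unitary p.1 /\ endo_det p.1 = expi p.2].

(* Derivatives relative to a set [A] (one-sided at the endpoints of a closed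
   interval); for operators, limits are taken in operator norm. *)
Definition is_op_derive_within (A : set R) (g : R -> 'End(H)) (t : R)
    (D : 'End(H)) : Prop :=
  opnorm (((s - t)^-1)%:C *: (g s - g t) - D) @[s --> within A t^'] --> (0 : R).

Definition is_real_derive_within (A : set R) (phi : R -> R) (t D : R) : Prop :=
  (s - t)^-1 * (phi s - phi t) @[s --> within A t^'] --> D.

Definition op_C1 (c d : R) (g : R -> 'End(H)) : Prop :=
  exists g' : R -> 'End(H), forall t, t \in `[c, d] ->
    is_op_derive_within `[c, d] g t (g' t) /\
    opnorm (g' s - g' t) @[s --> within `[c, d] (nbhs t)] --> (0 : R).

Definition real_C1 (c d : R) (phi : R -> R) : Prop :=
  exists phi' : R -> R,
    (forall t, t \in `[c, d] -> is_real_derive_within `[c, d] phi t (phi' t)) /\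
    {within `[c, d], continuous phi'}.

(* Being C1 on each closed subinterval, up to its endpoints, forces continuity
   at the subdivision points. *)
Definition piecewise_C1 (a b : R) (g : R -> 'End(H)) (phi : R -> R) : Prop :=
  exists2 s : seq R, itv_partition a b s &
    forall k, (k < size s)%N ->
      op_C1 (nth a (a :: s) k) (nth a (a :: s) k.+1) g /\
      real_C1 (nth a (a :: s) k) (nth a (a :: s) k.+1) phi.

(* The two-sided derivative; the default value 0 is only taken where it does
   not exist, on [a, b] a finite set for a piecewise C1 curve. *)
Definition velocity (g : R -> 'End(H)) (t : R) : 'End(H) :=
  xget 0 [set D | is_op_derive_within setT g t D].

Definition curve_length (a b : R) (g : R -> 'End(H)) : \bar R :=
  (\int[lebesgue_measure]_(t in `[a, b]) (opnorm (velocity g t))%:E)%E.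

Definition curve_joining (p q : 'End(H) * R) (a b : R)
    (g : R -> 'End(H)) (phi : R -> R) : Prop :=
  [/\ a < b, piecewise_C1 a b g phi,
      forall t, t \in `[a, b] -> unitary_cover (g t, phi t),
      (g a, phi a) = p & (g b, phi b) = q].

Definition cover_dist (p q : 'End(H) * R) : \bar R :=
  ereal_inf [set l | exists a b g phi,
    curve_joining p q a b g phi /\ l = curve_length a b g].

End UniversalCover.

Definition arguments (R : realType) (N : nat) (lambda : 'I_N -> R[i]) (x : R) :
    set ('I_N -> R) :=
  [set theta | (forall i, expi (theta i) = lambda i) /\
               \sum_(i < N) theta i = x].

Definition max_abs (R : realType) (N : nat) (theta : 'I_N -> R) : R :=
  \big[Num.max/0]_(i < N) `|theta i|.

Definition is_min (R : realType) (A : set R) (m : R) : Prop :=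
  A m /\ lbound A m.

(* Main.v *)
Require Import Defs.
From HB Require Import structures.
From mathcomp Require Import all_boot all_order all_algebra.
From mathcomp Require Import fingroup perm sesquilinear spectral.
From mathcomp Require Import all_classical all_reals all_analysis.
From mathcomp Require Import measurable_realfun complex.
From mathcomp Require Import ring lra.

(** Write [w = v u^-1] and let [m] be the least value of [max |theta_i|] over
    the families of arguments of the eigenvalues of [w] with sum [psi - phi].
    Such families form a discrete set, so the minimum is attained
    ([arguments_min]).

    Upper bound.  In an orthonormal eigenbasis [e_i] of [w], a minimising
    family [theta] defines the curve [g t = exp (i t X) u] with
    [X e_i = theta_i e_i].  It joins the two points in the cover because the
    [theta_i] sum to [psi - phi], and its speed is the norm of [X], at most
    [m] ([cover_dist_le]).

    Lower bound.  Along any curve [(g, f)] from [(u, phi)] to [(v, psi)] the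
    arguments of the eigenvalues of [g t u^-1] are followed from zero at the
    start, keeping their sum equal to [f t - phi]; if they never move faster
    than the curve, the arguments reached at the end are at most its length in
    absolute value, so [m] is at most the length.  Following them is the
    content of [eigenangles_follow]: when two unitaries differ by less than a
    short chord of the circle, their eigenvalues can be paired so that each
    moves by less than the corresponding arc.  By the pigeonhole principle the
    spectrum leaves a gap of fixed size ([spectral_gap]); cutting the circle in
    the gap, the eigenvalues of both unitaries are listed in increasing order
    of argument.  If the k-th arguments were too far apart, then the first
    [k + 1] eigenvectors of one and the last [n - k] of the other would span
    subspaces with a common unit vector [x]; [U x] would be close in angle to a
    fixed multiple of [x] and [V x] far from it, so that the spherical triangle
    inequality would keep [U x] and [V x] too far apart ([sorted_lt]).  Once
    every argument moves little, the sum of the arguments moves little too, and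
    the determinant, which fixes it up to [2 pi], fixes it completely
    ([eigenangles_follow_cover]).

    It remains to add up the small steps.  The ratio of arc to chord is below
    [1 + eps] when both are short ([chord_arc]), and near a time [t] the
    displacement of the curve and the integral of its speed are both
    [|s - t|] times the speed at [t], up to a small multiple of [|s - t|].  A
    continuity argument on each C1 piece ([real_induction], [piece_reach])
    turns this into a global bound with an error that vanishes with [eps]. *)

Set Implicit Arguments.
Unset Strict Implicit.
Unset Printing Implicit Defensive.

Import Order.TTheory GRing.Theory Num.Theory Num.Def.
Import numFieldNormedType.Exports.

Local Open Scope classical_set_scope.
Local Open Scope complex_scope.
Local Open Scope ring_scope.

(** * Angles on the circle *)

Section Circle.
Context {R : realType}.
Implicit Types (x y : R) (z : R[i]).

Lemma expi0 : expi (0 : R) = 1.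
Proof. by rewrite /expi cos0 sin0. Qed.

Lemma expiD x y : expi (x + y) = expi x * expi y.
Proof.
rewrite /expi cosD sinD; apply/eqP; rewrite eq_complex /=.
by rewrite eqxx addrC mulrC /= eqxx.
Qed.

Lemma conj_expi x : (expi x)^* = expi (- x).
Proof. by rewrite /expi cosN sinN. Qed.

Lemma expiNK x : expi (- x) * expi x = 1.
Proof. by rewrite -expiD addNr expi0. Qed.

Lemma expi_neq0 x : expi x != 0.
Proof.
by apply/eqP => e0; have /eqP := expiNK x; rewrite e0 mulr0 eq_sym oner_eq0.
Qed.

Lemma expi_sum (I : finType) (P : pred I) (t : I -> R) :
  expi (\sum_(i | P i) t i) = \prod_(i | P i) expi (t i).
Proof. by apply: (big_morph _ expiD expi0). Qed.

Lemma expi_2piM (k : int) : expi (k%:~R * (2 * pi) : R) = 1.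
Proof.
have nat_case (n : nat) : expi (n%:R * (2 * pi) : R) = 1.
  elim: n => [|n IH]; first by rewrite mul0r expi0.
  rewrite -natr1 mulrDl expiD IH mul1r mul1r /expi.
  by rewrite mulr_natl cos2pi sin2pi.
case: k => n; first exact: nat_case.
by rewrite NegzE mulrNz mulNr -conj_expi nat_case rmorph1.
Qed.

Lemma cos_eq1 x : `|x| <= pi -> cos x = 1 -> x = 0.
Proof.
move=> xpi; rewrite -cos_norm -cos0 => /cos_inj; rewrite !in_itv /= lexx pi_ge0.
by rewrite normr_ge0 xpi => /(_ isT isT) /eqP; rewrite normr_eq0 => /eqP.
Qed.

Lemma shift_2pi x y : exists k : int, y <= x - k%:~R * (2 * pi) < y + 2 * pi.
Proof.
have p0 : 0 < 2 * pi :> R by rewrite mulr_gt0 ?pi_gt0.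
exists (Num.floor ((x - y) / (2 * pi))).
have := ge_floor ((x - y) / (2 * pi)).
have := floorD1_gt ((x - y) / (2 * pi)); rewrite intrD1.
move: (_%:~R) => k; rewrite ltr_pdivrMr // ler_pdivlMr //.
by move: (2 * pi) => P; lra.
Qed.

(** Arguments of a unit complex number agree up to multiples of [2 pi]: move
    the difference to [-pi, pi), where the cosine equals 1 only at 0. *)
Lemma expi_inj x y : expi x = expi y -> exists k : int, x = y + k%:~R * (2 * pi).
Proof.
move=> exy; have [k /andP[k1 k2]] := shift_2pi (x - y) (- pi); exists k.
apply/eqP; rewrite -subr_eq0; apply/eqP; apply: cos_eq1.
  have -> : x - (y + k%:~R * (2 * pi)) = x - y - k%:~R * (2 * pi) by rewrite opprD addrA.
  move: k1 k2; rewrite ler_norml; move: (x - y - _) => a.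
  by have := @pi_gt0 R; lra.
have : expi (x - (y + k%:~R * (2 * pi))) = 1.
  rewrite opprD addrA !expiD exy -conj_expi -[in X in _ * X]conj_expi expi_2piM.
  by rewrite rmorph1 mulr1 conj_expi mulrC expiNK.
by rewrite /expi => -[].
Qed.

Lemma expi_surj z : z^* * z = 1 -> exists x, z = expi x.
Proof.
case: z => a b; simpc => -[e _].
have {}e : a ^+ 2 + b ^+ 2 = 1 by rewrite -e; ring.
have a1 : -1 <= a <= 1 by apply/andP; nra.
have s : sin (acos a) = `|b|.
  by rewrite sin_acos // -e addrC addKr sqrtr_sqr.
have ca : cos (acos a) = a by apply: acosK; rewrite in_itv.
have [b0|b0] := leP 0 b.
  by exists (acos a); rewrite /expi ca s ger0_norm.
by exists (- acos a); rewrite /expi cosN sinN ca s ltr0_norm // opprK.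
Qed.

Lemma expi_shift x y : exists2 x', y <= x' < y + 2 * pi & expi x' = expi x.
Proof.
have [k kP] := shift_2pi x y; exists (x - k%:~R * (2 * pi)) => //.
by rewrite expiD -conj_expi expi_2piM rmorph1 mulr1.
Qed.

(** The cosine decreases on [0, pi] and is symmetric about [pi]. *)
Lemma cos_le_arc x r : 0 <= r -> r <= x -> x <= 2 * pi - r -> cos x <= cos r.
Proof.
move=> r0 rx x2.
have le_cos u : r <= u -> u <= pi -> cos u <= cos r.
  move=> ru up; rewrite le_eqVlt; have [<-|ne] := eqVneq r u; first by rewrite eqxx.
  by rewrite ltr_cos ?in_itv /= ?r0 ?up ?andbT ?lt_neqAle ?ne ?ru ?orbT //; lra.
have [xp|xp] := leP x pi; first exact: le_cos.
have -> : cos x = cos (2 * pi - x).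
  rewrite cosB mulr_natl cos2pi sin2pi; ring.
by apply: le_cos; lra.
Qed.

Lemma ltr_cos_arc x r : 0 <= r -> `|x| <= 2 * pi - r -> cos r < cos x -> `|x| < r.
Proof.
move=> r0 x2; apply: contraTT; rewrite -!leNgt => rx.
by rewrite -(cos_norm x) cos_le_arc.
Qed.

End Circle.

(** * The real inner product and spherical angles *)

Section HilbertSpace.
Context {R : realType} {H : vectType R[i]} (form : {dot H for conjC}).
Implicit Types (x y z : H) (w : 'End(H)) (a : R).

Local Notation hnorm := (hnorm form).

(** The real part of a Hermitian form is a real inner product with the same
    norm; it is the one that measures angles between unit vectors. *)
Definition rdot x y : R := complex.Re (form x y).

Lemma dotC x y : form x y = (form y x)^*.
Proof. by rewrite hermC expr0 mul1r. Qed.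

Lemma dotDl x y z : form (x + y) z = form x z + form y z.
Proof. exact: linearDl. Qed.
Lemma dotNl x z : form (- x) z = - form x z.
Proof. exact: linearNl. Qed.
Lemma dotNr x z : form x (- z) = - form x z.
Proof. exact: linearNr. Qed.
Lemma dotZl (c : R[i]) x z : form (c *: x) z = c * form x z.
Proof. exact: linearZl_LR. Qed.
Lemma dotZr (c : R[i]) x z : form x (c *: z) = c^* * form x z.
Proof. exact: linearZr_LR. Qed.
Lemma dot0r x : form x 0 = 0.
Proof. exact: linear0r. Qed.
Lemma dot_suml n (F : 'I_n -> H) (P : pred 'I_n) z :
  form (\sum_(i | P i) F i) z = \sum_(i | P i) form (F i) z.
Proof. exact: linear_sumlz. Qed.
Lemma dot_sumr n (F : 'I_n -> H) (P : pred 'I_n) z :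
  form z (\sum_(i | P i) F i) = \sum_(i | P i) form z (F i).
Proof. exact: linear_sumr. Qed.

Lemma rdotC x y : rdot x y = rdot y x.
Proof. by rewrite /rdot dotC; case: (form y x). Qed.
Lemma rdotDl x y z : rdot (x + y) z = rdot x z + rdot y z.
Proof. by rewrite /rdot dotDl; case: (form x z) (form y z) => ? ? []. Qed.
Lemma rdotNl x z : rdot (- x) z = - rdot x z.
Proof. by rewrite /rdot dotNl; case: (form x z). Qed.
Lemma rdotZl a x z : rdot (a%:C *: x) z = a * rdot x z.
Proof. by rewrite /rdot dotZl; case: (form x z) => u v /=; rewrite mul0r subr0. Qed.
Lemma rdotDr x y z : rdot x (y + z) = rdot x y + rdot x z.
Proof. by rewrite rdotC rdotDl !(rdotC x). Qed.
Lemma rdotNr x z : rdot x (- z) = - rdot x z.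
Proof. by rewrite rdotC rdotNl (rdotC x). Qed.
Lemma rdotZr a x z : rdot x (a%:C *: z) = a * rdot x z.
Proof. by rewrite rdotC rdotZl (rdotC x). Qed.

Lemma dot_xx x : form x x = (rdot x x)%:C.
Proof.
by have := dnorm_ge0 form x; rewrite /rdot; case: (form x x) => u v /= /andP[/eqP -> _].
Qed.

Lemma rdot_ge0 x : 0 <= rdot x x.
Proof. by have := dnorm_ge0 form x; rewrite dot_xx ler0c. Qed.

Lemma rdot_eq0 x : (rdot x x == 0) = (x == 0).
Proof. by rewrite -(dnorm_eq0 form) dot_xx -(inj_eq (@complexI R)). Qed.

Lemma hnorm_ge0 x : 0 <= hnorm x. Proof. exact: sqrtr_ge0. Qed.

Lemma sqr_hnorm x : hnorm x ^+ 2 = rdot x x.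
Proof. by rewrite sqr_sqrtr // rdot_ge0. Qed.

Lemma hnorm_eq0 x : (hnorm x == 0) = (x == 0).
Proof. by rewrite -rdot_eq0 -sqr_hnorm sqrf_eq0. Qed.

Lemma hnorm0 : hnorm 0 = 0. Proof. by apply/eqP; rewrite hnorm_eq0. Qed.

Lemma hnorm_le x a : 0 <= a -> (hnorm x <= a) = (rdot x x <= a ^+ 2).
Proof. by move=> a0; rewrite -sqr_hnorm ler_pXn2r // nnegrE ?hnorm_ge0. Qed.

Lemma hnormZ a x : hnorm (a%:C *: x) = `|a| * hnorm x.
Proof.
apply/eqP; rewrite -(eqrXn2 (n := 2)) ?mulr_ge0 ?hnorm_ge0 //.
by rewrite exprMn !sqr_hnorm rdotZl rdotZr mulrA -expr2 real_normK ?num_real.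
Qed.

Lemma hnorm_expiZ a x : hnorm (expi a *: x) = hnorm x.
Proof.
by rewrite /Defs.hnorm dotZl dotZr mulrA conj_expi -expiD subrr expi0 mul1r.
Qed.

Lemma hnormN x : hnorm (- x) = hnorm x.
Proof. by rewrite /Defs.hnorm dotNl dotNr opprK. Qed.

Lemma cauchy_schwarz x y : rdot x y <= hnorm x * hnorm y.
Proof.
have [y0|y0] := eqVneq y 0.
  by rewrite y0 hnorm0 mulr0 /rdot dot0r.
have ny : 0 < hnorm y by rewrite lt_neqAle eq_sym hnorm_eq0 y0 hnorm_ge0.
have := rdot_ge0 ((hnorm y ^+ 2)%:C *: x - (rdot x y)%:C *: y).
rewrite !(rdotDl, rdotDr, rdotNl, rdotNr, rdotZl, rdotZr) (rdotC y x).
rewrite -!sqr_hnorm; move: (hnorm x) (hnorm y) (rdot x y) ny (hnorm_ge0 x) => a b c.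
move=> b0 a0 h; rewrite -subr_ge0 in h *.
have : 0 <= b ^+ 2 * ((a * b - c) * (a * b + c)) by rewrite (le_trans h) //; lra.
rewrite pmulr_rge0 ?exprn_gt0 // => {}h; have ab : 0 <= a * b by nra.
by case: (ltP c 0) => c0; [lra | nra].
Qed.

Lemma hnormD x y : hnorm (x + y) <= hnorm x + hnorm y.
Proof.
rewrite hnorm_le ?addr_ge0 ?hnorm_ge0 // rdotDl !rdotDr (rdotC y x).
by have := cauchy_schwarz x y; rewrite -!sqr_hnorm; lra.
Qed.

(** Triangle inequality on the unit sphere: if [y] lies within angle [r] of [x]
    and [z] at angle at least [r + s] from [x], then [y] and [z] are at angle
    at least [s].  Apply the Cauchy-Schwarz inequality to the components of [y]
    and [z] orthogonal to [x], whose norms are sines, and the addition formula. *)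
Lemma spherical_triangle x y z (r s : R) :
    hnorm x = 1 -> hnorm y = 1 -> hnorm z = 1 ->
    0 <= r -> 0 <= s -> r + s <= pi ->
    cos r <= rdot y x -> rdot z x <= cos (r + s) ->
  rdot y z <= cos s.
Proof.
move=> x1 y1 z1 r0 s0 rs yx zx.
have bnd u : hnorm u = 1 -> -1 <= rdot u x <= 1.
  move=> u1; have := cauchy_schwarz u x; have := cauchy_schwarz (- u) x.
  by rewrite rdotNl hnormN u1 x1 mulr1 => h1 h2; apply/andP; split; lra.
have cosA u : hnorm u = 1 -> cos (acos (rdot u x)) = rdot u x.
  by move=> u1; apply: acosK; rewrite in_itv; exact: bnd.
have sinA u : hnorm u = 1 ->
    hnorm (u - (rdot u x)%:C *: x) = sin (acos (rdot u x)).
  move=> u1; rewrite sin_acos ?bnd // /Defs.hnorm -/(rdot _ _); congr Num.sqrt.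
  rewrite !(rdotDl, rdotDr, rdotNl, rdotNr, rdotZl, rdotZr) (rdotC x u).
  by rewrite -!sqr_hnorm u1 x1; ring.
have := cauchy_schwarz (y - (rdot y x)%:C *: x) (z - (rdot z x)%:C *: x).
rewrite !sinA // !(rdotDl, rdotDr, rdotNl, rdotNr, rdotZl, rdotZr) (rdotC x z).
rewrite -(sqr_hnorm x) x1.
set A := acos (rdot y x); set B := acos (rdot z x) => h.
have Ar : A <= r.
  rewrite leNgt; apply/negP => rA; have Api : A <= pi by apply/acos_lepi/bnd.
  have : cos A < cos r by rewrite ltr_cos ?in_itv /= ?r0 //; lra.
  by rewrite cosA // ltNge yx.
have sB : r + s <= B.
  rewrite leNgt; apply/negP => Bs; have B0 : 0 <= B by apply/acos_ge0/bnd.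
  have : cos (r + s) < cos B by rewrite ltr_cos ?in_itv /= ?addr_ge0 ?B0 //; lra.
  by rewrite cosA // ltNge zx.
have A0 : 0 <= A by apply/acos_ge0/bnd.
have Bpi : B <= pi by apply/acos_lepi/bnd.
have : cos (B - A) <= cos s by apply: cos_le_arc; lra.
rewrite cosB !cosA // => h2; apply: le_trans h2.
by move: h; lra.
Qed.

End HilbertSpace.

(** * Orthonormal eigenbases of unitary operators *)

Section Frames.
Context {R : realType} {H : vectType R[i]} (form : {dot H for conjC}).
Implicit Types (x y z : H) (w : 'End(H)).

Definition orthoframe n (e : 'I_n -> H) : Prop :=
  forall i j, form (e i) (e j) = (i == j)%:R.

Lemma frame_comb n (e : 'I_n -> H) (c : 'I_n -> R[i]) (j : 'I_n) :
  orthoframe e -> form (\sum_i c i *: e i) (e j) = c j.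
Proof.
move=> oe; rewrite dot_suml (bigD1 j) //= dotZl oe eqxx mulr1.
by rewrite big1 ?addr0 // => i /negbTE ij; rewrite dotZl oe ij mulr0.
Qed.

(** An orthonormal family is free, so one with [\dim H] members is a basis, and
    its coordinates are the inner products. *)
Lemma frame_expand n (e : 'I_n -> H) x : \dim {:H} = n -> orthoframe e ->
  x = \sum_i form x (e i) *: e i.
Proof.
move=> dimH oe; pose X := [tuple e i | i < n].
have Xi (i : 'I_n) : X`_i = e i by rewrite -tnth_nth tnth_mktuple.
have fX : free X.
  apply/freeP => c c0 i; have := frame_comb c i oe.
  under eq_bigr do rewrite -Xi.
  by rewrite c0 linear0l.
have bX : basis_of {:H} X.
  by rewrite basisEfree fX subvf size_tuple dimH leqnn.
rewrite [LHS](coord_basis bX) ?memvf //; apply: eq_bigr => i _.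
rewrite Xi; congr (_ *: _).
rewrite [in RHS](coord_basis bX (memvf x)).
under eq_bigr do rewrite Xi.
by rewrite (frame_comb (fun k => coord X k x)).
Qed.

Lemma frame_form n (e : 'I_n -> H) (c d : 'I_n -> R[i]) : orthoframe e ->
  form (\sum_i c i *: e i) (\sum_i d i *: e i) = \sum_i c i * (d i)^*.
Proof.
move=> oe; rewrite dot_sumr; apply: eq_bigr => j _.
by rewrite dotZr frame_comb // mulrC.
Qed.

Lemma unitary_hnorm w x : unitary form w -> hnorm form (w x) = hnorm form x.
Proof. by case=> _ uw; rewrite /hnorm uw. Qed.

Definition eigenframe w n (e : 'I_n -> H) (t : 'I_n -> R) : Prop :=
  orthoframe e /\ forall i, w (e i) = expi (t i) *: e i.

Lemma unit_eigenvalue w x (c : R[i]) :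
  unitary form w -> x != 0 -> w x = c *: x -> exists t, c = expi t.
Proof.
move=> [_ uw] x0 wx; apply: expi_surj.
have := uw x x; rewrite wx dotZl dotZr mulrA => /eqP.
rewrite -subr_eq0 -{2}[form x x]mul1r -mulrBl mulf_eq0 dnorm_eq0 (negbTE x0).
by rewrite orbF subr_eq0 mulrC => /eqP.
Qed.

(** The orthogonal complement of a family of eigenvectors of a unitary operator
    is stable under the operator.  In coordinates it is the kernel of a
    matrix with fewer columns than rows, so it is not zero and contains an
    eigenvector. *)
Lemma eigenframe_extend w k (e : 'I_k -> H) t :
    unitary form w -> (k < \dim {:H})%N -> eigenframe w e t ->
  exists e' t', @eigenframe w k.+1 e' t'.
Proof.
move=> uw kn [oe we]; set n := \dim {:H} in kn *.
pose b := vbasis {:H}; pose A := endo_mx w.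
have bb : basis_of {:H} b by apply: vbasisP.
pose M := \matrix_(j < n, i < k) form b`_j (e i).
have vM (v : 'rV_n) i : (v *m M) 0 i = form (passmx.vecof b v) (e i).
  rewrite mxE /passmx.vecof dot_suml; apply: eq_bigr => j _.
  by rewrite dotZl mxE.
have orth_stable x i : form x (e i) = 0 -> form (w x) (e i) = 0.
  move=> xe; have := uw.2 x (e i); rewrite we dotZr xe => /eqP.
  by rewrite mulf_eq0 conj_expi (negbTE (expi_neq0 _)) => /eqP.
have KA : (row_base (kermx M) *m A <= row_base (kermx M))%MS.
  rewrite eq_row_base (eqmxMr _ (eq_row_base _)).
  apply/row_subP => j; apply/sub_kermxP/rowP => i.
  rewrite row_mul; set v := row j (kermx M).
  have vM0 : v *m M = 0 by rewrite /v -row_mul mulmx_ker row0.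
  rewrite vM mxE /A /endo_mx passmx.mul_mxof passmx.rVofK //.
  by apply: orth_stable; rewrite -vM vM0 mxE.
have rK : (0 < \rank (kermx M))%N.
  by rewrite mxrank_ker subn_gt0 (leq_ltn_trans (rank_leq_col _)).
have [B KB] := submxP KA; have [c /eigenvalueP[v vB v0]] := eigenvalue_closed B rK.
pose x := passmx.vecof b (v *m row_base (kermx M)).
have x0 : x != 0.
  by rewrite passmx.vecof_eq0 // mulmx_free_eq0 ?row_base_free.
have wx : w x = c *: x.
  rewrite /x (passmx.hom_vecof _ bb) -/(endo_mx w) -/A -mulmxA KB mulmxA vB.
  rewrite -scalemxAl /passmx.vecof scaler_sumr; apply: eq_bigr => i _.
  by rewrite mxE scalerA.
have xe i : form x (e i) = 0.
  rewrite -vM -mulmxA; set K := row_base _ *m M.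
  have -> : K = 0 by apply/sub_kermxP; rewrite eq_row_base.
  by rewrite mulmx0 mxE.
have [s cs] := unit_eigenvalue uw x0 wx.
pose x1 := ((hnorm form x)^-1)%:C *: x.
have nx0 : hnorm form x != 0 by rewrite hnorm_eq0.
have x1x1 : form x1 x1 = 1.
  by rewrite dot_xx -sqr_hnorm hnormZ normfV ger0_norm ?hnorm_ge0 ?mulVf ?expr1n.
have x1e i : form x1 (e i) = 0 by rewrite dotZl xe mulr0.
pose ex (T : Type) (f : 'I_k -> T) (y : T) (i : 'I_k.+1) := oapp f y (unlift ord_max i).
exists (ex _ e x1), (ex _ t s); split.
  move=> i j; rewrite /ex; case: (unliftP ord_max i) => [i'|] ->; case: (unliftP ord_max j) => [j'|] -> /=.
  - by rewrite oe (inj_eq lift_inj).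
  - by rewrite dotC x1e rmorph0 eq_sym (negbTE (neq_lift _ _)).
  - by rewrite x1e (negbTE (neq_lift _ _)).
  - by rewrite x1x1 eqxx.
move=> i; rewrite /ex; case: (unliftP ord_max i) => [i'|] _ /=; first exact: we.
by rewrite /x1 linearZ /= wx -cs !scalerA mulrC.
Qed.

Theorem unitary_eigenframe w n : unitary form w -> \dim {:H} = n ->
  exists e t, @eigenframe w n e t.
Proof.
move=> uw dimH; suff: forall k, (k <= n)%N -> exists e t, @eigenframe w k e t.
  exact.
elim=> [_|k IH kn].
  by exists (fun=> 0), (fun=> 0); split=> [[]|[]].
have [e [t et]] := IH (ltnW kn).
by apply: (eigenframe_extend uw _ et); rewrite dimH.
Qed.

(** The change of basis matrix [P] to the eigenbasis satisfies [P A = D P], with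
    [A] the matrix of [w] and [D] diagonal; it is invertible because its
    product with the matrix of inner products is the identity. *)
Lemma eigenframe_char_poly w n (e : 'I_n -> H) (t : 'I_n -> R) :
    \dim {:H} = n -> eigenframe w e t ->
  endo_char_poly w = \prod_i ('X - (expi (t i))%:P).
Proof.
move=> dimH; case: n / dimH e t => e t [oe we].
set n := \dim {:H} in e t oe we *; pose b := vbasis {:H}.
have bb : basis_of {:H} b by apply: vbasisP.
pose P : 'M[R[i]]_n := \matrix_(i, j) passmx.rVof b (e i) 0 j.
pose G : 'M[R[i]]_n := \matrix_(j, k) form b`_j (e k).
have PG : P *m G = 1%:M.
  apply/matrixP => i k; rewrite mxE [RHS]mxE -oe.
  rewrite -(passmx.rVofK bb (e i)) /passmx.vecof dot_suml.
  by apply: eq_bigr => j _; rewrite dotZl !mxE.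
have P0 : \det P != 0.
  have := congr1 determinant PG; rewrite det_mulmx det1 => /eqP.
  by apply: contraTneq => ->; rewrite mul0r eq_sym oner_eq0.
pose D : 'M[R[i]]_n := diag_mx (\row_i expi (t i)).
have PA : P *m endo_mx w = D *m P.
  apply/row_matrixP => i; rewrite row_mul.
  have Pi : row i P = passmx.rVof b (e i) by apply/rowP => j; rewrite !mxE.
  rewrite [in LHS]Pi -(passmx.rVof_app _ bb) we; apply/rowP => j.
  by rewrite mul_diag_mx !mxE linearZ.
rewrite /endo_char_poly; have -> : char_poly (endo_mx w) = char_poly D.
  pose P' := map_mx polyC P.
  have P'0 : \det P' != 0 by rewrite det_map_mx polyC_eq0.
  apply: (mulfI P'0); rewrite -det_mulmx mulrC -det_mulmx; congr (\det _).
  by rewrite /char_poly_mx mulmxBr mulmxBl scalar_mxC -!map_mxM PA.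
rewrite char_poly_trig ?diag_mx_is_trig //; apply: eq_bigr => i _.
by rewrite !mxE eqxx.
Qed.

(** The constant coefficient of the characteristic polynomial is the determinant
    up to sign. *)
Lemma eigenframe_det w n (e : 'I_n -> H) (t : 'I_n -> R) :
    \dim {:H} = n -> eigenframe w e t ->
  endo_det w = expi (\sum_i t i).
Proof.
move=> dimH et; have := eigenframe_char_poly dimH et.
move/(congr1 (fun p : {poly R[i]} => p`_0)).
rewrite /endo_char_poly char_poly_det -/(endo_det w) expi_sum dimH.
rewrite -horner_coef0 horner_prod.
under eq_bigr do rewrite hornerXsubC sub0r.
rewrite prodrN card_ord => /(mulfI _); apply.
by rewrite signr_eq0.
Qed.

End Frames.

(** * Matching the eigenvalues of two nearby unitaries *)

Section Matching.
Context {R : realType} {H : vectType R[i]} (form : {dot H for conjC}).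
Implicit Types (x y z : H) (w U V : 'End(H)).

(** The squared modulus as a real number; the norm of [R[i]] takes values in
    [R[i]]. *)
Definition sqnc (z : R[i]) : R := complex.Re z ^+ 2 + complex.Im z ^+ 2.

Lemma sqnc_ge0 (c : R[i]) : 0 <= sqnc c.
Proof. by rewrite addr_ge0 ?sqr_ge0. Qed.

(** The angle between [w x] and a rotation of [x]: a mean of the cosines of the
    angular distances, weighted by the squared coordinates of [x]. *)
Lemma rdot_eigenframe w n (e : 'I_n -> H) (t : 'I_n -> R) (c : R) x :
    \dim {:H} = n -> eigenframe form w e t ->
  rdot form (w x) (expi c *: x) =
    \sum_i sqnc (form x (e i)) * cos (t i - c).
Proof.
move=> dimH [oe we]; rewrite {1 2}(frame_expand x dimH oe).
rewrite linear_sum scaler_sumr /=.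
under eq_bigr do rewrite linearZ /= we scalerA.
under [X in rdot _ _ X]eq_bigr do rewrite scalerA.
rewrite /rdot (frame_form (fun i => _ * _) (fun i => _ * _)) // raddf_sum /=.
apply: eq_bigr => i _; rewrite cosB rmorphM /= conj_expi /expi sinN cosN.
by rewrite /sqnc; case: (form x (e i)) => a b /=; simpc; ring.
Qed.

Lemma sum_sqnc n (e : 'I_n -> H) x : \dim {:H} = n -> orthoframe form e ->
  \sum_i sqnc (form x (e i)) = hnorm form x ^+ 2.
Proof.
move=> dimH oe; rewrite sqr_hnorm /rdot [in RHS](frame_expand x dimH oe).
rewrite (frame_form (form x \o e) (form x \o e)) // raddf_sum /=.
by apply: eq_bigr => i _; rewrite /sqnc; case: (form x (e i)) => a b /=; simpc; ring.
Qed.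

Lemma rdot_eigenframe_ge w n (e : 'I_n -> H) (t : 'I_n -> R) (c b : R) x :
    \dim {:H} = n -> eigenframe form w e t -> hnorm form x = 1 ->
    (forall i, form x (e i) != 0 -> b <= cos (t i - c)) ->
  b <= rdot form (w x) (expi c *: x).
Proof.
move=> dimH et x1 bt; rewrite (rdot_eigenframe _ _ dimH et).
have := sum_sqnc x dimH et.1; rewrite x1 expr1n => s1.
rewrite -[b]mul1r -s1 mulr_suml; apply: ler_sum => i _.
have [->|/bt] := eqVneq (form x (e i)) 0; last by move=> ?; rewrite ler_wpM2l ?sqnc_ge0.
by rewrite /sqnc /= expr0n addr0 !mul0r.
Qed.

Lemma rdot_eigenframe_le w n (e : 'I_n -> H) (t : 'I_n -> R) (c b : R) x :
    \dim {:H} = n -> eigenframe form w e t -> hnorm form x = 1 ->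
    (forall i, form x (e i) != 0 -> cos (t i - c) <= b) ->
  rdot form (w x) (expi c *: x) <= b.
Proof.
move=> dimH et x1 bt; rewrite (rdot_eigenframe _ _ dimH et).
have := sum_sqnc x dimH et.1; rewrite x1 expr1n => s1.
rewrite -[b]mul1r -s1 mulr_suml; apply: ler_sum => i _.
have [->|/bt] := eqVneq (form x (e i)) 0; last by move=> ?; rewrite ler_wpM2l ?sqnc_ge0.
by rewrite /sqnc /= expr0n addr0 !mul0r.
Qed.

Definition close U V (d : R) : Prop :=
  forall x, hnorm form (U x - V x) <= d * hnorm form x.

Lemma closeC U V d : close U V d -> close V U d.
Proof. by move=> UV x; rewrite -opprB hnormN. Qed.

(** The squared distance between the unit vectors [U x] and [V x] is
    [2 - 2 <U x, V x>]. *)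
Lemma close_rdot U V d x : unitary form U -> unitary form V ->
  close U V d -> hnorm form x = 1 -> 2 - 2 * rdot form (U x) (V x) <= d ^+ 2.
Proof.
move=> uU uV UV x1; have := UV x; rewrite x1 mulr1 => le_d.
have d0 : 0 <= d := le_trans (hnorm_ge0 _ _) le_d.
move: le_d; rewrite hnorm_le //.
rewrite !(rdotDl, rdotDr, rdotNl, rdotNr) (rdotC _ (V x)).
by rewrite -!sqr_hnorm !unitary_hnorm // x1; lra.
Qed.

Lemma hnormalize x : x != 0 -> exists2 a : R[i], a != 0 & hnorm form (a *: x) = 1.
Proof.
move=> x0; have nx0 : hnorm form x != 0 by rewrite hnorm_eq0.
exists ((hnorm form x)^-1)%:C; first by rewrite eq_complex /= invr_eq0 (negbTE nx0).
by rewrite hnormZ normfV ger0_norm ?hnorm_ge0 ?mulVf.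
Qed.

(** The span of [e_0, ..., e_k] and that of [f_k, ..., f_(n-1)] have dimensions
    with sum [n + 1], hence share a unit vector. *)
Lemma frames_meet n (e f : 'I_n -> H) (k : 'I_n) :
    orthoframe form e -> orthoframe form f ->
  exists x, [/\ hnorm form x = 1,
    forall i : 'I_n, (k < i)%N -> form x (e i) = 0 &
    forall j : 'I_n, (j < k)%N -> form x (f j) = 0].
Proof.
move=> oe of_.
(* The columns j < k impose orthogonality to f_j and the columns j > k the
   vanishing of the coordinate j; the column k is zero, so M is singular. *)
pose M : 'M[R[i]]_n := \matrix_(i, j) if (j < k)%N then form (e i) (f j)
  else if j == k then 0 else (i == j)%:R.
have /det0P[c c0 cM] : \det M == 0.
  rewrite (expand_det_col _ k) big1 // => i _.
  by rewrite mxE ltnn eqxx mul0r.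
pose x := \sum_i c 0 i *: e i.
have xe i : form x (e i) = c 0 i by rewrite (frame_comb (fun i => c 0 i)).
have x0 : x != 0.
  apply: contraNneq c0 => x0; apply/eqP/rowP => i.
  by rewrite -xe x0 linear0l mxE.
have [a a0 ax1] := hnormalize x0; exists (a *: x); split=> // i ki.
  rewrite dotZl xe; have := congr1 (fun A : 'rV_n => A 0 i) cM; rewrite !mxE.
  rewrite (bigD1 i) //= big1 ?addr0 => [|j /negbTE ji].
    by rewrite mxE ltnNge ltnW // gt_eqF // eqxx mulr1 => ->; rewrite mulr0.
  by rewrite mxE ltnNge ltnW // gt_eqF // ji mulr0.
have := congr1 (fun A : 'rV_n => A 0 i) cM; rewrite !mxE => cMi.
rewrite dotZl (_ : form x (f i) = 0) ?mulr0 //.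
rewrite /x dot_suml -[RHS]cMi; apply: eq_bigr => j _.
by rewrite dotZl mxE ki.
Qed.

(** Comparison of the k-th arguments.  The hypothesis on [d] says that a chord
    of length [d] subtends an arc smaller than [r].  The common vector of
    [frames_meet] has its [U]-arguments in [[l, s k]], an arc with centre [c]
    and half-width [q], and, should the conclusion fail, its [V]-arguments in
    an arc whose points are all at angle at least [q + r] from [c]; the
    arc of width [2 h >= r] below [l], free of arguments of [V], is what bounds
    the latter from the other side. *)
Lemma sorted_lt U V n (e f : 'I_n -> H) (s t : 'I_n -> R) (l h d r : R)
    (k : 'I_n) :
    \dim {:H} = n -> unitary form U -> unitary form V -> close U V d ->
    eigenframe form U e s -> eigenframe form V f t ->
    {homo s : i j / (i <= j)%N >-> i <= j} ->
    {homo t : i j / (i <= j)%N >-> i <= j} ->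
    (forall i, l <= s i) -> (forall i, t i <= l + 2 * pi - 2 * h) ->
    0 <= r <= 2 * h -> d ^+ 2 < 2 - 2 * cos r ->
  t k < s k + r.
Proof.
move=> dimH uU uV UV es ft homs homt ls tl /andP[r0 rh] dr.
rewrite ltNge; apply/negP => st.
have [x [x1 xe xf]] := frames_meet k es.1 ft.1.
pose c := (l + s k) / 2; pose q := (s k - l) / 2.
have := close_rdot uU uV UV x1; apply/negP; rewrite -ltNge.
apply: (lt_le_trans dr); rewrite lerD2l lerN2 ler_pM2l //.
have lsk := ls k; have tlk := tl k.
apply: (@spherical_triangle _ _ _ (expi c *: x) _ _ q);
  rewrite ?hnorm_expiZ ?unitary_hnorm //; try by rewrite /q; lra.
  apply: (rdot_eigenframe_ge dimH es x1) => i xi.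
  have ik : (i <= k)%N by rewrite leqNgt; apply: contraNN xi => /xe ->.
  have := homs _ _ ik; have := ls i => lsi sik.
  rewrite -(cos_norm (s i - c)).
  have : `|s i - c| <= q by rewrite ler_norml /c /q; apply/andP; lra.
  rewrite le_eqVlt => /predU1P[-> //|lt_q]; apply/ltW.
  rewrite ltr_cos // in_itv /= ?normr_ge0 ?(ltW (le_lt_trans _ lt_q)) //.
    by rewrite (le_trans (ltW lt_q)) // /q; lra.
  by rewrite /q; lra.
apply: (rdot_eigenframe_le dimH ft x1) => j xj.
have kj : (k <= j)%N by rewrite leqNgt; apply: contraNN xj => /xf ->.
have := homt _ _ kj; have := tl j => tlj tkj.
by apply: cos_le_arc; rewrite /c /q; lra.
Qed.

(** If all arguments of [U] were at angle at least [r] from [t], so would be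
    [U x] from [V x]. *)
Lemma eigenangle_near U V n (e : 'I_n -> H) (s : 'I_n -> R) (d r t : R) x :
    \dim {:H} = n -> unitary form U -> unitary form V -> close U V d ->
    eigenframe form U e s -> V x = expi t *: x -> hnorm form x = 1 ->
    d ^+ 2 < 2 - 2 * cos r ->
  exists i, cos r < cos (s i - t).
Proof.
move=> dimH uU uV UV es Vx x1 dr; apply: contrapT => noi.
have := close_rdot uU uV UV x1; apply/negP; rewrite -ltNge.
apply: (lt_le_trans dr); rewrite lerD2l lerN2 ler_pM2l // Vx.
apply: (rdot_eigenframe_le dimH es x1) => i _.
by rewrite leNgt; apply/negP => h; apply: noi; exists i.
Qed.

Lemma sort_angles n (s : 'I_n -> R) : exists p : {perm 'I_n},
  {homo s \o p : i j / (i <= j)%N >-> i <= j}.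
Proof.
pose t := [tuple s i | i < n].
have : perm_eq (sort <=%R t) t by rewrite perm_sort.
case/tuple_permP => p tp; exists p => i j ij /=.
have nthE (i' : 'I_n) : nth 0 (sort <=%R t) i' = s (p i').
  by rewrite tp -tnth_nth !tnth_mktuple.
rewrite -!nthE; apply: sorted_leq_nth => //; try exact: le_trans.
- exact: sort_le_sorted.
- by rewrite inE size_sort size_tuple.
- by rewrite inE size_sort size_tuple.
Qed.

(** Cut the circle into [n + 1] equal arcs: one of them contains none of the [n]
    points, and [y] is taken at its middle. *)
Lemma spectral_gap n (s : 'I_n -> R) : let g : R := pi / n.+1%:R in
  exists (y : R) (s' : 'I_n -> R), forall i,
    expi (s' i) = expi (s i) /\ y + g <= s' i <= y + 2 * pi - g.
Proof.
move=> g; have g0 : 0 < g by rewrite divr_gt0 ?pi_gt0.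
have g2_gt0 : 0 < 2 * g by rewrite mulr_gt0.
have g2 : n.+1%:R * (2 * g) = 2 * pi by rewrite mulrCA [n.+1%:R * _]mulrC /g divfK // pnatr_eq0.
have /choice[a aP] i : exists a : R, 0 <= a < 2 * pi /\ expi a = expi (s i).
  by have [a aP ea] := expi_shift (s i) 0; exists a; rewrite add0r in aP.
pose k i := Num.truncn (a i / (2 * g)).
have kP i : (k i)%:R * (2 * g) <= a i < (k i).+1%:R * (2 * g).
  have [/andP[a0 _] _] := aP i.
  rewrite -(ler_pdivlMr _ _ g2_gt0) -(ltr_pdivrMr _ _ g2_gt0).
  by apply: truncn_itv; rewrite divr_ge0 // mulr_ge0 // ltW.
have kn i : (k i < n.+1)%N.
  have [/andP[_ a2] _] := aP i; have /andP[ka _] := kP i.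
  by rewrite -(ltr_nat R) -(ltr_pM2r g2_gt0) /= g2 (le_lt_trans ka).
have [m mk] : exists m : 'I_n.+1, forall i, k i != m.
  pose f i := Ordinal (kn i).
  have /subsetPn[m _ mf] : ~~ ('I_n.+1 \subset codom f).
    apply/negP => /subset_leq_card; rewrite card_ord leqNgt ltnS.
    by rewrite (leq_trans (leq_image_card _ _)) ?card_ord.
  by exists m => i; apply: contraNneq mf => ki; apply/codomP; exists i; apply/val_inj.
exists ((m%:R + 1 / 2) * (2 * g)).
(* Arguments below the empty arc are moved up by a full turn, so that all of
   them lie between its upper end and its lower end one turn later. *)
exists (fun i => if (k i < m)%N then a i + 2 * pi else a i) => i.
have [/andP[a0 a2] ea] := aP i; have /andP[ka1 ka2] := kP i.
have m0 : 0 <= m%:R * (2 * g) by rewrite mulr_ge0 ?ler0n ?(ltW g2_gt0).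
have mn : m.+1%:R * (2 * g) <= 2 * pi by rewrite -g2 ler_wpM2r ?(ltW g2_gt0) // ler_nat ltn_ord.
have Sm : m.+1%:R * (2 * g) = m%:R * (2 * g) + 2 * g by rewrite -natr1; ring.
have -> : (m%:R + 1 / 2) * (2 * g) = m%:R * (2 * g) + g by field.
case: ltnP => km; split=> //.
- by have := expi_2piM (R := R) 1; rewrite expiD mul1r ea => ->; rewrite mulr1.
- have : (k i).+1%:R * (2 * g) <= m%:R * (2 * g) by rewrite ler_wpM2r ?(ltW g2_gt0) // ler_nat.
  by move=> ?; apply/andP; split; lra.
have {}km : (m < k i)%N by rewrite ltn_neqAle km eq_sym mk.
have : m.+1%:R * (2 * g) <= (k i)%:R * (2 * g) by rewrite ler_wpM2r ?(ltW g2_gt0) // ler_nat.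
by move=> ?; apply/andP; split; lra.
Qed.

Lemma eigenframe_perm w n (e : 'I_n -> H) (t : 'I_n -> R) (p : {perm 'I_n}) :
  eigenframe form w e t -> eigenframe form w (e \o p) (t \o p).
Proof.
move=> [oe we]; split=> [i j|i] /=; last exact: we.
by rewrite oe (inj_eq perm_inj).
Qed.

(** The arguments of [U], listed in increasing order from the middle [y] of a
    gap, are compared with those of [V] in the same order.  The latter also
    avoid a neighbourhood of [y], so [sorted_lt] applies in both directions.
    The displacements found for the arguments in [[y, y + 2 pi)] are then
    applied to the given arguments [s]. *)
Theorem eigenangles_follow U V n (e : 'I_n -> H) (s : 'I_n -> R) (d r : R) :
    \dim {:H} = n -> unitary form U -> unitary form V -> close U V d ->
    eigenframe form U e s ->
    0 < r -> 3 * r <= 2 * (pi / n.+1%:R) -> d ^+ 2 < 2 - 2 * cos r ->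
  exists f t, eigenframe form V f t /\ forall i, `|t i - s i| < r.
Proof.
move=> dimH uU uV UV es r0 rn dr; set g := pi / _ in rn.
have [y [a aP]] := spectral_gap s; rewrite -/g in aP.
have ea : eigenframe form U e a.
  by split=> [|i]; [exact: es.1 | rewrite es.2 (aP i).1].
have [f [b0 fb0]] := unitary_eigenframe uV dimH.
have /choice[b bP] i :
    exists b : R, y <= b < y + 2 * pi /\ expi b = expi (b0 i).
  by have [b bP eb] := expi_shift (b0 i) y; exists b.
have fb : eigenframe form V f b.
  by split=> [|i]; [exact: fb0.1 | rewrite fb0.2 (bP i).2].
(* An argument of V is within r of one of U, hence at distance at least
   g - r from the cut. *)
have b_gap j : y + g - r <= b j <= y + 2 * pi - g + r.
  have fj1 : hnorm form (f j) = 1.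
    by rewrite /hnorm fb.1 eqxx sqrtr1.
  have [k] := eigenangle_near dimH uU uV UV ea (fb.2 j) fj1 dr.
  have [_ aPi] := aP k; have [bPj _] := bP j; move: aPi bPj => /andP[a1 a2] /andP[b1 b2].
  move/(ltr_cos_arc (ltW r0)); rewrite ler_norml ltr_norml => h.
  have /andP[] : - r < a k - b j < r by apply: h; lra.
  by move=> *; apply/andP; lra.
have [p pa] := sort_angles a; have [q qb] := sort_angles b.
have ep := eigenframe_perm p ea; have fq := eigenframe_perm q fb.
have ab k : `|b (q k) - a (p k)| < r.
  rewrite ltr_norml; apply/andP; split.
    have : (a \o p) k < (b \o q) k + r.
      apply: (sorted_lt (l := y + g - r) (h := g - r) _ dimH uV uU (closeC UV)
        fq ep qb pa) => //.
      - by move=> i; have /andP[] := b_gap (q i).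
      - by move=> i /=; have [_ aPi] := aP (p i); lra.
      - by apply/andP; lra.
    by rewrite /=; lra.
  have : (b \o q) k < (a \o p) k + r.
    apply: (sorted_lt (l := y + g - r) (h := g - r) _ dimH uU uV UV ep fq pa qb)
      => //.
    - by move=> i /=; have [_ aPi] := aP (p i); lra.
    - by move=> i /=; have /andP[] := b_gap (q i); lra.
    - by apply/andP; lra.
  by rewrite /=; lra.
exists (f \o (p^-1 * q)%g), (fun i => s i + (b ((p^-1 * q)%g i) - a i)); split.
  split=> [|i]; first exact: (eigenframe_perm _ fb).1.
  rewrite (eigenframe_perm _ fb).2 /=; congr (_ *: _).
  rewrite expiD -(aP i).1 -expiD; congr expi; ring.
move=> i; have := ab (p^-1 i)%g; rewrite permKV permM.
by rewrite addrAC subrr add0r.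
Qed.

(** The determinant fixes the sum of the new arguments modulo [2 pi], and the
    displacements are too small for that sum to be off by a nonzero multiple. *)
Lemma eigenangles_follow_cover U V n (e : 'I_n -> H) (s : 'I_n -> R)
    (a b d r : R) :
    \dim {:H} = n -> unitary_cover form (U, a) -> unitary_cover form (V, b) ->
    close U V d -> `|b - a| <= 1 ->
    eigenframe form U e s -> \sum_i s i = a ->
    0 < r -> 3 * r <= 2 * (pi / n.+1%:R) -> d ^+ 2 < 2 - 2 * cos r ->
  exists (f : 'I_n -> H) (t : 'I_n -> R), [/\ eigenframe form V f t, \sum_i t i = b &
    forall i, `|t i - s i| < r].
Proof.
move=> dimH [/= uU dU] [/= uV dV] UV ba es sa r0 rn dr.
have [f [t [ft ts]]] := eigenangles_follow dimH uU uV UV es r0 rn dr.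
exists f, t; split=> //.
have := eigenframe_det dimH ft; rewrite dV => /esym/expi_inj[k tk].
suff -> : \sum_i t i = b by [].
have : `|\sum_i t i - \sum_i s i| <= n%:R * r.
  rewrite -sumrB (le_trans (ler_norm_sum _ _ _)) //.
  rewrite (le_trans (ler_sum _ (fun i _ => ltW (ts i)))) //.
  by rewrite sumr_const card_ord mulr_natl.
(* The total displacement is below 2 pi / 3, and the phase changes by at
   most 1; together they stay below 2 pi. *)
have nr : n%:R * r < 2 * pi / 3.
  have : n.+1%:R * (3 * r) <= 2 * pi.
    have := ler_wpM2l (ler0n R n.+1) rn.
    by rewrite [X in _ <= X]mulrCA [n.+1%:R * (_ / _)]mulrC divfK // pnatr_eq0.
  by rewrite -natr1; lra.
rewrite sa tk => t_near.
have [->|k0] := eqVneq k 0; first by rewrite mul0r addr0.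
have k1 : 1 <= `|k%:~R : R| by rewrite norm_intr_ge1 ?intr_int // intr_eq0.
exfalso; have := @pi_ge2 R; move: (k%:~R) (pi) nr ba k1 t_near => c p.
move: (n%:R * r) => q; rewrite !ler_norml ler_normr; clear.
move=> q_lt /andP[ba1 ba2] /orP[c1|c1] /andP[h1 h2] p2; nra.
Qed.

End Matching.

(** * The operator norm, chords and arcs *)

Section Operators.
Context {R : realType} {H : vectType R[i]} (form : {dot H for conjC}).
Implicit Types (x y z : H) (w U V f g : 'End(H)).

Local Notation hnorm := (hnorm form).
Local Notation opnorm := (opnorm form).

Lemma hnorm_sum n (F : 'I_n -> H) :
  hnorm (\sum_i F i) <= \sum_i hnorm (F i).
Proof.
elim/big_ind2: _ => [|x a y b xa yb|//]; first by rewrite hnorm0.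
exact: le_trans (hnormD _ _ _) (lerD xa yb).
Qed.

Lemma sqr_hnormZ (c : R[i]) x : hnorm (c *: x) ^+ 2 = sqnc c * hnorm x ^+ 2.
Proof.
rewrite !sqr_hnorm /rdot dotZl dotZr [form x x]dot_xx /sqnc.
by case: c => a b; simpc => /=; ring.
Qed.

(** On the unit ball the coordinates in an orthonormal basis are at most 1, so
    the sum of the norms of the images of the basis is a bound. *)
Lemma opnorm_has_sup f :
  has_sup [set hnorm (f x) | x in [set x | hnorm x <= 1]].
Proof.
split; first by exists (hnorm (f 0)), 0 => //=; rewrite hnorm0 ler01.
have u1 : unitary form \1%VF.
  by split=> [|x y]; [exists id => x; rewrite lfunE | rewrite !lfunE].
have [e [t [oe _]]] := unitary_eigenframe u1 erefl.
exists (\sum_i hnorm (f (e i))) => _ [x /= x1 <-].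
rewrite {1}(frame_expand x erefl oe) linear_sum /=.
apply: (le_trans (hnorm_sum _)); apply: ler_sum => i _.
rewrite linearZ /= -(ler_pXn2r (n := 2)) ?nnegrE ?hnorm_ge0 //.
rewrite sqr_hnormZ ler_piMl ?sqr_ge0 //.
have /(le_trans _) : hnorm x ^+ 2 <= 1 by rewrite expr_le1 ?hnorm_ge0.
apply; rewrite -(sum_sqnc x erefl oe) (bigD1 i) //= lerDl.
by apply: sumr_ge0 => j _; apply: sqnc_ge0.
Qed.

Lemma opnorm_ge0 f : 0 <= opnorm f.
Proof.
apply: (sup_upper_bound (opnorm_has_sup f)); exists 0 => /=.
  by rewrite hnorm0 ler01.
by rewrite linear0 hnorm0.
Qed.

Lemma le_opnorm f x : hnorm (f x) <= opnorm f * hnorm x.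
Proof.
have [->|x0] := eqVneq x 0; first by rewrite linear0 hnorm0 mulr0.
have nx0 : 0 < hnorm x by rewrite lt_neqAle eq_sym hnorm_eq0 x0 hnorm_ge0.
rewrite -ler_pdivrMr //; apply: (sup_upper_bound (opnorm_has_sup f)).
exists (((hnorm x)^-1)%:C *: x) => /=.
  by rewrite hnormZ normfV gtr0_norm // mulVf // gt_eqF.
by rewrite linearZ /= hnormZ normfV gtr0_norm // mulrC.
Qed.

Lemma opnorm_le f (M : R) : 0 <= M ->
  (forall x, hnorm (f x) <= M * hnorm x) -> opnorm f <= M.
Proof.
move=> M0 fM; apply: ge_sup; first by have [] := opnorm_has_sup f.
by move=> _ [x /= x1 <-]; rewrite (le_trans (fM x)) // ler_piMr.
Qed.

Lemma opnorm_eq0 f : opnorm f = 0 -> f = 0.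
Proof.
move=> f0; apply/lfunP => x; apply/eqP; rewrite lfunE /= -(hnorm_eq0 form).
by rewrite eq_le hnorm_ge0 andbT (le_trans (le_opnorm f x)) // f0 mul0r.
Qed.

Lemma opnormN f : opnorm (- f) = opnorm f.
Proof.
by congr sup; apply: eq_imagel => x _; rewrite opp_lfunE hnormN.
Qed.

Lemma opnormD f g : opnorm (f + g) <= opnorm f + opnorm g.
Proof.
apply: opnorm_le => [|x]; first by rewrite addr_ge0 ?opnorm_ge0.
by rewrite add_lfunE mulrDl (le_trans (hnormD _ _ _)) // lerD ?le_opnorm.
Qed.

Lemma opnormB_ge f g : opnorm f - opnorm g <= opnorm (f - g).
Proof. by rewrite lerBlDr -{1}(subrK g f) opnormD. Qed.

Lemma opnorm_close U V (d : R) : opnorm (U - V) <= d -> close form U V d.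
Proof.
move=> UVd x; have := le_opnorm (U - V) x; rewrite add_lfunE opp_lfunE => h.
by rewrite (le_trans h) // ler_wpM2r ?hnorm_ge0.
Qed.

End Operators.

Section RealLine.
Context {R : realType}.

(** The arc [r] subtends the chord [2 sin (r / 2)], and by the mean value
    theorem [sin (r / 2)] is [r / 2] times a cosine that is close to 1. *)
Lemma chord_arc (eps : R) : 0 < eps ->
  exists2 r0 : R, 0 < r0 & forall r, 0 < r <= r0 ->
    (r / (1 + eps)) ^+ 2 < 2 - 2 * cos r.
Proof.
move=> eps0.
have h : cos x @[x --> (0 : R)] --> cos (0 : R) by apply: continuous_cos.
have : \forall x \near (0 : R), (1 + eps)^-1 < cos x.
  by apply: (cvgr_gt _ h); rewrite cos0 invf_lt1 ?ltrDl // addr_gt0.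
move=> /nbhs_ballP[q /= q0 qP].
exists (Num.min q 1) => [|r /andP[r0]]; first by rewrite lt_min q0 /=.
rewrite le_min => /andP[rq r1].
have p2 := @pi_ge2 R.
have r20 : 0 < r / 2 by rewrite divr_gt0.
have [c] : exists2 c, c \in `]0, (r / 2)[ &
    sin (r / 2) - sin 0 = cos c * (r / 2 - 0).
  apply: MVT => //.
  by apply: continuous_subspaceT => x; apply: continuous_sin.
rewrite in_itv /= sin0 !subr0 => /andP[c0 cr] sinE.
have cc : (1 + eps)^-1 < cos c.
  by apply: qP; rewrite /ball /= sub0r normrN gtr0_norm //; lra.
have -> : 2 - 2 * cos r = (2 * sin (r / 2)) ^+ 2.
  rewrite [in cos r](_ : r = (r / 2) *+ 2); last by rewrite -mulr_natr divfK.
  by rewrite cos_mulr2n exprMn sin2cos2; ring.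
have i0 : 0 < (1 + eps)^-1 by rewrite invr_gt0 addr_gt0.
rewrite ltr_pXn2r // ?nnegrE.
- by rewrite sinE; move: ((1 + eps)^-1) cc i0 => *; nra.
- by rewrite mulr_ge0 // ltW.
- by rewrite sinE; nra.
Qed.

(** A property that spreads from left to right near each point, and only by
    comparison with that point, spreads over the whole interval: consider the
    supremum of the points where it holds. *)
Lemma real_induction (a b : R) (P : R -> Prop) : a <= b -> P a ->
    (forall t, a <= t <= b -> exists2 d : R, 0 < d & forall s,
      a <= s <= b -> `|s - t| < d ->
      (s < t -> P s -> P t) /\ (t < s -> P t -> P s)) ->
  P b.
Proof.
move=> ab Pa loc; pose S := [set t | a <= t <= b /\ P t].
have Sa : S a by split=> //; rewrite lexx.
have supS : has_sup S by split; [exists a | exists b => t [/andP[_]]].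
have ac : a <= sup S by apply: sup_upper_bound.
have cb : sup S <= b.
  by apply: ge_sup; [exists a | move=> t [/andP[_]]].
have [|d d0 dP] := loc (sup S); first by rewrite ac cb.
have Pc : P (sup S).
  have [s [sab Ps] ds] := sup_adherent d0 supS.
  have sc : s <= sup S by apply: sup_upper_bound => //; split.
  have [<-//|sc'] := eqVneq s (sup S).
  have {}sc : s < sup S by rewrite lt_neqAle sc' sc.
  by apply: (dP s sab _).1 => //; rewrite ltr0_norm ?subr_lt0 //; lra.
have [<-//|cb'] := eqVneq (sup S) b.
have {cb'}cb : sup S < b by rewrite lt_neqAle cb' cb.
pose s := Num.min b (sup S + d / 2).
have cs : sup S < s by rewrite lt_min cb ltrDl divr_gt0.
have sb : s <= b by rewrite ge_min lexx.
have sd : s <= sup S + d / 2 by rewrite ge_min lexx orbT.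
have sab : a <= s <= b by rewrite sb (le_trans ac) // ltW.
have Ps : P s.
  by apply: (dP s sab _).2 => //; rewrite gtr0_norm ?subr_gt0 //; lra.
have : s <= sup S by apply: sup_upper_bound.
by rewrite leNgt cs.
Qed.

End RealLine.

(** * Lifting the spectrum along a piece of a curve *)

Section LowerBound.
Context {R : realType} {H : vectType R[i]} (form : {dot H for conjC}).
Implicit Types (x y z : H) (w U V : 'End(H)).

Local Notation hnorm := (hnorm form).
Local Notation opnorm := (opnorm form).
Local Notation mu := (@lebesgue_measure R).

Lemma unitary_comp U V : unitary form U -> unitary form V ->
  unitary form (U \o V)%VF.
Proof.
move=> [bU uU] [bV uV]; split=> [|x y]; last by rewrite !comp_lfunE /= uU uV.
by apply: (eq_bij (bij_comp bU bV)) => x; rewrite comp_lfunE.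
Qed.

Lemma unitary_invK U x : unitary form U -> U (U^-1%VF x) = x.
Proof.
move=> [[V UV VU] _]; rewrite -{1}(VU x).
have /lker0P U0 : injective U by exact: can_inj UV.
by rewrite lker0_lfunK.
Qed.

Lemma unitary_inv U : unitary form U -> unitary form U^-1%VF.
Proof.
move=> uU; have [[V UV VU] uf] := uU.
have /lker0P U0 : injective U by exact: can_inj UV.
split=> [|x y]; last by rewrite -uf !unitary_invK.
exists U => x; first exact: unitary_invK.
by rewrite lker0_lfunK.
Qed.

Lemma endo_det_comp U V : endo_det (U \o V)%VF = endo_det U * endo_det V.
Proof.
by rewrite /endo_det /endo_mx (passmx.mxof_comp _ _ (vbasisP _)) det_mulmx mulrC.
Qed.

Lemma cover_div U V (a b : R) : unitary_cover form (U, a) ->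
  unitary_cover form (V, b) -> unitary_cover form ((V \o U^-1)%VF, b - a).
Proof.
move=> [/= uU dU] [/= uV dV]; split=> /=.
  exact: unitary_comp uV (unitary_inv uU).
apply: (mulIf (expi_neq0 a)); rewrite -expiD subrK -dU -endo_det_comp -dV.
congr endo_det; apply/lfunP => x; rewrite !comp_lfunE /=.
have [[W UW WU] _] := uU.
have /lker0P U0 : injective U by exact: can_inj UW.
by rewrite lker0_lfunK.
Qed.

(** The property propagated along a curve from [p]: the eigenvalues of the
    quotient have been followed from zero to arguments that are bounded by
    the length [M] covered so far. *)
Definition reach (p : 'End(H) * R) n (q : 'End(H) * R) (M : R) : Prop :=
  exists (e : 'I_n -> H) (s : 'I_n -> R),
    [/\ eigenframe form (q.1 \o p.1^-1)%VF e s, \sum_i s i = q.2 - p.2 &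
        forall i, `|s i| <= M].

Lemma reach_refl p n : \dim {:H} = n -> unitary_cover form p -> reach p n p 0.
Proof.
move=> dimH cp; have [/= up _] := cp.
have [e [t [oe _]]] := unitary_eigenframe (unitary_inv up) dimH.
exists e, (fun=> 0); split=> [|/=|i]; last by rewrite normr0.
- split=> // i; rewrite expi0 scale1r comp_lfunE; exact: unitary_invK.
- by rewrite big1 ?subrr.
Qed.

Lemma reach_le p n q (M M' : R) : M <= M' -> reach p n q M -> reach p n q M'.
Proof.
move=> MM [e [s [es ss sM]]]; exists e, s; split=> // i.
exact: le_trans (sM i) MM.
Qed.

Lemma reach_step p n q q' (M d r : R) :
    \dim {:H} = n -> unitary_cover form p ->
    unitary_cover form q -> unitary_cover form q' ->
    reach p n q M -> close form q.1 q'.1 d -> `|q'.2 - q.2| <= 1 ->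
    0 < r -> 3 * r <= 2 * (pi / n.+1%:R) -> d ^+ 2 < 2 - 2 * cos r ->
  reach p n q' (M + r).
Proof.
case: p q q' => [u a] [w b] [w' b'] dimH cu cw cw' [e [s [es ss sM]]] /= ww bb.
move=> r0 rn dr.
have cl : close form (w \o u^-1)%VF (w' \o u^-1)%VF d.
  move=> x; rewrite !comp_lfunE /= (le_trans (ww _)) //.
  by rewrite (unitary_hnorm _ (unitary_inv cu.1)).
have bb' : `|(b' - a) - (b - a)| <= 1 by rewrite opprB addrA subrK.
have [f [t [ft tb ts]]] := eigenangles_follow_cover dimH (cover_div cu cw)
  (cover_div cu cw') cl bb' es ss r0 rn dr.
exists f, t; split=> // i.
rewrite -(subrK (s i) (t i)) (le_trans (ler_normD _ _)) // addrC lerD //.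
exact: ltW.
Qed.

Lemma cvg_withinP (A : set R) (F : R -> R) (t l : R) :
    F s @[s --> within A t^'] --> l -> forall eta, 0 < eta ->
  exists2 d : R, 0 < d &
    forall s, A s -> s != t -> `|s - t| < d -> `|F s - l| < eta.
Proof.
move=> /cvgrPdistC_lt F0 eta /F0; rewrite near_withinE /prop_near1.
move=> /nbhs_ballP[d /= d0 dP]; exists d => // s As st sd.
by apply: dP => //; rewrite /ball /= distrC.
Qed.

Lemma cvg0_withinP (A : set R) (F : R -> R) (t : R) :
    F s @[s --> within A t^'] --> (0 : R) -> forall eta, 0 < eta ->
  exists2 d : R, 0 < d & forall s, A s -> s != t -> `|s - t| < d -> `|F s| < eta.
Proof.
move=> F0 eta /(cvg_withinP F0)[d d0 dP]; exists d => // s As st sd.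
by rewrite -[F s]subr0 dP.
Qed.

(** At an interior point the derivative relative to the interval is two-sided,
    and derivatives are unique. *)
Lemma velocityE (c d : R) (g : R -> 'End(H)) (t : R) D :
    c < t < d -> is_op_derive_within form `[c, d] g t D ->
  velocity form g t = D.
Proof.
move=> /andP[ct td] gD.
have gD' : is_op_derive_within form setT g t D.
  move: gD; rewrite /is_op_derive_within => /cvgr0Pnorm_lt gD.
  apply/cvgr0Pnorm_lt => eta /gD; rewrite !near_withinE => h.
  have cd : \forall s \near t^', `[c, d]%classic s.
    have tcd : t \in `]c, d[ by rewrite in_itv /= ct.
    rewrite near_withinE; apply: filterS (near_in_itvoo tcd) => s + st /=.
    by rewrite !in_itv /= => /andP[cs sd]; rewrite !ltW.
  apply: filterS2 h cd => s hs cs st _; exact: hs st (cs st).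
rewrite /velocity; case: xgetP => [D' _ /= gD2|/(_ D)//].
apply/eqP; rewrite -subr_eq0; apply/eqP; apply: (@opnorm_eq0 _ _ form).
apply/eqP; rewrite eq_le opnorm_ge0 andbT; apply/ler_addgt0Pl => eta eta0.
rewrite addr0; have eta2 : 0 < eta / 2 by rewrite divr_gt0.
have [d1 d10 h1] := cvg0_withinP gD' eta2.
have [d2 d20 h2] := cvg0_withinP gD2 eta2.
pose m := Num.min d1 d2; have m0 : 0 < m by rewrite lt_min d10.
have mE : `|t + m / 2 - t| < m.
  by rewrite addrAC subrr add0r gtr0_norm ?divr_gt0 // ltr_pdivrMr // ltr_pMr // ltr1n.
have st : t + m / 2 != t by rewrite -subr_eq0 addrAC subrr add0r gt_eqF // divr_gt0.
move: mE; rewrite lt_min => /andP[/(h1 _ I st) {}h1 /(h2 _ I st) {}h2].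
move: h1 h2; rewrite !ger0_norm ?opnorm_ge0 //; set Q := _ *: _ => h1 h2.
have -> : D' - D = (Q - D) - (Q - D') by rewrite opprB [RHS]addrC addrA subrK.
apply: (le_trans (opnormD _ _ _)); rewrite opnormN.
by rewrite [eta]splitr lerD // ltW.
Qed.

(** A lower bound for the speed on an open interval makes the length grow at
    least linearly; the endpoints do not count. *)
Lemma integral_itv_ge (v : R -> R) (c s t k : R) :
    c <= s -> s < t -> measurable_fun `[c, t] v -> (forall r, 0 <= v r) ->
    (forall r, s < r < t -> k <= v r) ->
  (\int[mu]_(r in `[c, s]) (v r)%:E + (k * (t - s))%:E
    <= \int[mu]_(r in `[c, t]) (v r)%:E)%E.
Proof.
move=> cs st mv v0 kv.
have E : `[c, t]%classic = `[c, s] `|` `]s, t] :> set R.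
  by apply: itv_bndbnd_setU; rewrite bnd_simp // ltW.
rewrite E ge0_integral_setU //=; last 3 first.
- by rewrite -E; exact/measurable_EFinP.
- by move=> x _; rewrite lee_fin.
- apply/disj_setPS => x [] /=; rewrite !in_itv /= => /andP[_ xs] /andP[sx _].
  by move: (lt_le_trans sx xs); rewrite ltxx.
rewrite leeD2l //.
have mst : measurable_fun `]s, t[ (EFin \o v).
  apply/measurable_EFinP; apply: measurable_funS mv => // x /=.
  by rewrite !in_itv /= => /andP[sx xt]; rewrite (le_trans cs) ?ltW.
have [k0|k0] := ltP k 0.
  apply: (@le_trans _ _ 0%E).
    by rewrite lee_fin nmulr_rle0 // subr_ge0 ltW.
  by apply: integral_ge0 => x _; rewrite lee_fin.
rewrite (integral_itv_bndoo (f := EFin \o v)) //.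
have -> : (k * (t - s))%:E = (\int[mu]_(r in `]s, t[) (cst k%:E r))%E.
  by rewrite integral_cst //= lebesgue_measure_itv /= lte_fin st.
exact: ge0_le_integral.
Qed.

Lemma opnormZ_le (a : R) U : opnorm (a%:C *: U) <= `|a| * opnorm U.
Proof.
apply: opnorm_le => [|x]; first by rewrite mulr_ge0 ?opnorm_ge0.
by rewrite scale_lfunE hnormZ -mulrA ler_wpM2l // le_opnorm.
Qed.

(** Real induction on [t].  Put [f = opnorm (g' t)].  For [s] near [t] the
    derivative gives a displacement of at most [(f + eta) |s - t|], which by
    [chord_arc] moves the arguments by at most [K |s - t|] with
    [K = (1 + eps) (f + 2 eta)], while the speed is at least [f - eta] between
    [s] and [t].  The discrepancy is [3 eta = eps] per unit of time, which is
    the term [eps * (t - c)] of the bound. *)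
Lemma piece_reach p n (g : R -> 'End(H)) (phi : R -> R) (c d M eps : R) :
    let v r := opnorm (velocity form g r) in
    \dim {:H} = n -> unitary_cover form p -> 0 < eps -> c < d ->
    (forall t, t \in `[c, d] -> unitary_cover form (g t, phi t)) ->
    op_C1 form c d g -> real_C1 c d phi -> measurable_fun `[c, d] v ->
    (\int[mu]_(r in `[c, d]) (v r)%:E < +oo)%E ->
    reach p n (g c, phi c) M ->
  reach p n (g d, phi d)
    (M + (1 + eps) * (fine (\int[mu]_(r in `[c, d]) (v r)%:E) + eps * (d - c))).
Proof.
move=> v dimH cp eps0 cd cg [g' g'P] [phi' [phi'P _]] mv vfin reach_c.
have v0 r : 0 <= v r by apply: opnorm_ge0.
pose I t : \bar R := (\int[mu]_(r in `[c, t]) (v r)%:E)%E.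
have I0 t : (0 <= I t)%E by apply: integral_ge0 => r _; rewrite lee_fin.
have Ifin t : t <= d -> I t \is a fin_num.
  move=> td; rewrite ge0_fin_numE // (le_lt_trans _ vfin) //.
  apply: ge0_subset_integral => //=.
  - exact/measurable_EFinP.
  - by move=> r _; rewrite lee_fin.
  - by move=> r /=; rewrite !in_itv /= => /andP[-> rt]; rewrite (le_trans rt).
have Igrow s t k : c <= s -> s < t -> t <= d -> (forall r, s < r < t -> k <= v r) ->
    fine (I s) + k * (t - s) <= fine (I t).
  move=> cs st td kv; rewrite -lee_fin EFinD !fineK ?Ifin //.
    apply: integral_itv_ge => //; apply: measurable_funS mv => // r /=.
    by rewrite !in_itv /= => /andP[-> rt]; rewrite (le_trans rt).
  exact: le_trans (ltW st) td.
pose P t := reach p n (g t, phi t) (M + (1 + eps) * (fine (I t) + eps * (t - c))).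
apply: (@real_induction R c d P); rewrite ?(ltW cd) //.
  by rewrite /P subrr mulr0 addr0 /I set_itv1 integral_set1 mulr0 addr0.
move=> t tcd; have tcd' : t \in `[c, d] by rewrite in_itv.
have [g't cg't] := g'P t tcd'.
pose f := opnorm (g' t); pose eta := eps / 3.
have eta0 : 0 < eta by rewrite divr_gt0.
have f0 : 0 <= f by apply: opnorm_ge0.
have [d1 d10 h1] := cvg0_withinP g't eta0.
have [d2 d20 h2] : exists2 d2 : R, 0 < d2 & forall s, c <= s <= d ->
    s != t -> `|s - t| < d2 -> `|phi s - phi t| <= 1.
  have [q q0 qP] := cvg_withinP (phi'P t tcd') ltr01.
  pose B := `|phi' t| + 1; have B0 : 0 < B by rewrite ltr_wpDl.
  exists (Num.min q B^-1); first by rewrite lt_min q0 invr_gt0.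
  move=> s scd st; rewrite lt_min => /andP[sq sB].
  have st0 : 0 < `|s - t| by rewrite normr_gt0 subr_eq0.
  have := qP s; rewrite /= in_itv /= scd st => /(_ isT isT sq) h.
  have -> : phi s - phi t = (s - t) * ((s - t)^-1 * (phi s - phi t)).
    by rewrite mulVKf // subr_eq0.
  set Q := _^-1 * _ in h *; have QB : `|Q| <= B.
    by rewrite -(subrK (phi' t) Q) (le_trans (ler_normD _ _)) // addrC lerD2l ltW.
  rewrite normrM (le_trans (ler_wpM2l (normr_ge0 _) QB)) //.
  by rewrite -ler_pdivlMr // mul1r ltW.
have [d3 d30 h3] : exists2 d3 : R, 0 < d3 & forall s, c <= s <= d ->
    `|s - t| < d3 -> f - eta <= opnorm (g' s).
  move: cg't => /cvgr0Pnorm_lt/(_ _ eta0); rewrite near_withinE /prop_near1.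
  move=> /nbhs_ballP[q /= q0 qP]; exists q => // s scd sq.
  have := qP s; rewrite /ball /= distrC in_itv /= => /(_ sq scd).
  rewrite ger0_norm ?opnorm_ge0 // -opnormN opprB => h.
  by have := opnormB_ge form (g' t) (g' s); rewrite -/f; lra.
have [r0 r00 r0P] := chord_arc eps0.
(* The second eta makes the step strictly longer than the displacement, and
   thus positive, even where the speed vanishes. *)
pose K := (1 + eps) * (f + 2 * eta).
have K0 : 0 < K by apply: mulr_gt0; lra.
have [m m0 [mr mn]] : exists2 m, 0 < m & K * m <= r0 /\
    3 * (K * m) <= 2 * (pi / n.+1%:R).
  pose X : R := 2 * (pi / n.+1%:R); have X0 : 0 < X by rewrite mulr_gt0 ?divr_gt0 ?pi_gt0.
  exists (Num.min (r0 / K) (X / (3 * K))).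
    by rewrite lt_min !divr_gt0 // mulr_gt0.
  split; first by rewrite mulrC -ler_pdivlMr // ge_min lexx.
  rewrite -/X mulrA [leLHS]mulrC -ler_pdivlMr; last by rewrite mulr_gt0.
  by rewrite ge_min lexx orbT.
exists (Num.min m (Num.min d1 (Num.min d2 d3))); first by rewrite !lt_min m0 d10 d20.
move=> s scd; rewrite !lt_min => /and4P[sm sd1 sd2 sd3].
have near_close : s != t ->
  [/\ close form (g s) (g t) ((f + eta) * `|s - t|),
     `|phi s - phi t| <= 1, 0 < K * `|s - t|, 3 * (K * `|s - t|) <= 2 * (pi / n.+1%:R) &
      ((f + eta) * `|s - t|) ^+ 2 < 2 - 2 * cos (K * `|s - t|)].
  move=> st; have st0 : 0 < `|s - t| by rewrite normr_gt0 subr_eq0.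
  split.
  - apply: opnorm_close; have := h1 s; rewrite /= in_itv /= scd st => /(_ isT isT sd1).
    rewrite ger0_norm ?opnorm_ge0 // => /ltW hQ.
    have -> : g s - g t = (s - t)%:C *: (((s - t)^-1)%:C *: (g s - g t)).
      by rewrite scalerA -rmorphM mulfV ?subr_eq0 // scale1r.
    rewrite (le_trans (opnormZ_le _ _)) // mulrC ler_wpM2r //.
    set Q := _ *: _ in hQ *; rewrite -(subrK (g' t) Q).
    by rewrite (le_trans (opnormD _ _ _)) // addrC lerD2l.
  - exact: h2.
  - exact: mulr_gt0.
  - by rewrite (le_trans _ mn) // ler_pM2l // ler_pM2l // ltW.
  - apply: le_lt_trans (r0P (K * `|s - t|) _).
      have -> : K * `|s - t| / (1 + eps) = (f + 2 * eta) * `|s - t|.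
        by rewrite /K; field; rewrite gt_eqF ?addr_gt0.
      by rewrite ler_pXn2r ?nnegrE ?ler_pM2r ?mulr_ge0 //; lra.
    by rewrite mulr_gt0 // (le_trans _ mr) // ler_pM2l // ltW.
have v_ge r : c < r < d -> `|r - t| < d3 -> f - eta <= v r.
  move=> /andP[cr rd] rt; have rcd : r \in `[c, d] by rewrite in_itv /= !ltW.
  rewrite /v (velocityE _ (g'P r rcd).1) ?cr ?rd // h3 //.
have eps3 : eps = 3 * eta by rewrite /eta; field.
split=> [st Ps|ts Pt].
  have [cl ph k0 k1 k2] := near_close (negbT (lt_eqF st)).
  have := reach_step dimH cp (cg s _) (cg t tcd') Ps cl; rewrite in_itv /=.
  rewrite distrC => /(_ _ scd ph k0 k1 k2); apply: reach_le.
  have := Igrow s t (f - eta); have /andP[cs _] := scd; have /andP[_ td] := tcd.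
  move=> /(_ cs st td); rewrite ltr0_norm ?subr_lt0 // opprB => h.
  have {}h : fine (I s) + (f - eta) * (t - s) <= fine (I t).
    apply: h => r /andP[sr rt]; apply: v_ge; first by rewrite (le_lt_trans cs sr) (lt_le_trans rt td).
    by move: sd3; rewrite !ltr0_norm ?subr_lt0 //; lra.
  rewrite -addrA lerD2l /K -mulrA -mulrDr ler_pM2l ?addr_gt0 //.
  by rewrite eps3; move: h; lra.
have st : s != t by rewrite gt_eqF.
have [cl ph k0 k1 k2] := near_close st.
have := reach_step dimH cp (cg t tcd') (cg s _) Pt (closeC cl); rewrite in_itv /=.
move=> /(_ _ scd ph k0 k1 k2); apply: reach_le.
have := Igrow t s (f - eta); have /andP[ct _] := tcd; have /andP[_ sd] := scd.
move=> /(_ ct ts sd); rewrite gtr0_norm ?subr_gt0 // => h.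
have {}h : fine (I t) + (f - eta) * (s - t) <= fine (I s).
  apply: h => r /andP[tr rs]; apply: v_ge; first by rewrite (le_lt_trans ct tr) (lt_le_trans rs sd).
  by move: sd3; rewrite !gtr0_norm ?subr_gt0 //; lra.
rewrite -addrA lerD2l /K -mulrA -mulrDr ler_pM2l ?addr_gt0 //.
by rewrite eps3; move: h; lra.
Qed.

End LowerBound.

(** * Lifting the spectrum along a whole curve *)

Section Curves.
Context {R : realType} {H : vectType R[i]} (form : {dot H for conjC}).
Implicit Types (U V : 'End(H)).

Local Notation opnorm := (opnorm form).
Local Notation mu := (@lebesgue_measure R).

(** The speed is continuous inside the interval, and on the two endpoints every
    function is measurable. *)
Lemma piece_measurable (g : R -> 'End(H)) (c d : R) :
  op_C1 form c d g -> measurable_fun `[c, d] (fun r => opnorm (velocity form g r)).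
Proof.
move=> [g' g'P]; apply: (measurable_fun_itv_cc (b0 := false) (b1 := true)).
apply: (eq_measurable_fun (fun r => opnorm (g' r))).
  move=> r /[1!inE] /= rcd; congr opnorm; apply/esym.
  have [rP _] := g'P r (subset_itv_oo_cc rcd).
  by apply: velocityE rP; move: rcd; rewrite in_itv.
apply: open_continuous_measurable_fun; first exact: interval_open.
move=> t /[1!inE] /= tcd; apply/cvgrPdist_lt => e e0.
have [_ /cvgr0Pnorm_lt/(_ _ e0)] := g'P t (subset_itv_oo_cc tcd).
rewrite near_withinE => h; apply: filterS2 h (near_in_itvoo tcd) => s hs scd.
have {hs} := hs (subset_itv_oo_cc scd); rewrite ger0_norm ?opnorm_ge0 // => hs.
rewrite ltr_norml; apply/andP; split.
  have := opnormB_ge form (g' s) (g' t); move: hs.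
  by move: (opnorm (_ - _)) => q; lra.
have := opnormB_ge form (g' t) (g' s).
rewrite -(opnormN form (g' t - g' s)) opprB; move: hs.
by move: (opnorm (_ - _)) => q; lra.
Qed.

(** Induction on the pieces.  Measurability of the speed is carried along because
    the additivity of the integral requires it. *)
Lemma pieces_reach p n (g : R -> 'End(H)) (phi : R -> R) (eps : R) s a :
    let v r := opnorm (velocity form g r) in
    let b := last a s in
    \dim {:H} = n -> unitary_cover form p -> 0 < eps -> path <%O a s ->
    (forall t, t \in `[a, b] -> unitary_cover form (g t, phi t)) ->
    (forall k, (k < size s)%N ->
      op_C1 form (nth a (a :: s) k) (nth a (a :: s) k.+1) g /\
      real_C1 (nth a (a :: s) k) (nth a (a :: s) k.+1) phi) ->
  measurable_fun `[a, b] v /\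
  forall M, (\int[mu]_(r in `[a, b]) (v r)%:E < +oo)%E ->
    reach form p n (g a, phi a) M ->
  reach form p n (g b, phi b)
    (M + (1 + eps) * (fine (\int[mu]_(r in `[a, b]) (v r)%:E) + eps * (b - a))).
Proof.
move=> v b dimH cp eps0; rewrite {}/b; elim: s a => [|c s IH] a /= pas cov C1s.
  rewrite set_itv1; split=> [|M _ reach_a]; first exact: measurable_fun_set1.
  by rewrite integral_set1 subrr mulr0 add0r mulr0 addr0.
have v0 r : 0 <= v r by apply: opnorm_ge0.
move: pas => /andP[ac pcs]; set b := last c s in IH cov *.
have cb : c <= b by apply: (itv_partition_le (s := s)); split.
have [C1g C1phi] := C1s 0%N isT; rewrite /= in C1g C1phi.
have mac := piece_measurable C1g.
have [||mcb reach_cb] := IH c pcs.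
- by move=> t; rewrite in_itv /= => /andP[ct tb]; apply: cov; rewrite in_itv /= tb (le_trans (ltW ac)).
- move=> k ks; have := C1s k.+1 ks.
  by rewrite /= !(set_nth_default a c) //= ltnW.
have E : `[a, b]%classic = `[a, c] `|` `]c, b] :> set R.
  by apply: itv_bndbnd_setU; rewrite bnd_simp // ltW.
have mcb' : measurable_fun `]c, b] v.
  apply: measurable_funS mcb => // r /=.
  by rewrite !in_itv /= => /andP[/ltW -> ->].
have mab : measurable_fun `[a, b] v by rewrite E; apply/measurable_funU.
split=> // M.
have -> : (\int[mu]_(r in `[a, b]) (v r)%:E =
    \int[mu]_(r in `[a, c]) (v r)%:E + \int[mu]_(r in `[c, b]) (v r)%:E)%E.
  rewrite E ge0_integral_setU //=.
  - congr (_ + _)%E; apply: (integral_itv_obnd_cbnd (f := EFin \o v)).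
    exact/measurable_EFinP.
  - by rewrite -E; exact/measurable_EFinP.
  - by move=> x _; rewrite lee_fin.
  - apply/disj_setPS => x [] /=; rewrite !in_itv /= => /andP[_ xs] /andP[sx _].
    by move: (lt_le_trans sx xs); rewrite ltxx.
set I1 := (\int[mu]_(r in `[a, c]) _)%E; set I2 := (\int[mu]_(r in `[c, b]) _)%E.
have I10 : (0 <= I1)%E by apply: integral_ge0 => r _; rewrite lee_fin.
have I20 : (0 <= I2)%E by apply: integral_ge0 => r _; rewrite lee_fin.
move=> fin12 reach_a.
have fI1 : I1 \is a fin_num by rewrite ge0_fin_numE // (le_lt_trans _ fin12) ?leeDl.
have fI2 : I2 \is a fin_num by rewrite ge0_fin_numE // (le_lt_trans _ fin12) ?leeDr.
have reach_c := piece_reach dimH cp eps0 ac _ C1g C1phi mac _ reach_a.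
have {}reach_c := reach_c _ _; rewrite fineD //.
have -> (x y : R) : M + (1 + eps) * (x + y + eps * (b - a)) =
    M + (1 + eps) * (x + eps * (c - a)) + (1 + eps) * (y + eps * (b - c)) by ring.
apply: reach_cb; first by rewrite -ge0_fin_numE.
apply: reach_c; last by rewrite -ge0_fin_numE.
move=> t; rewrite in_itv /= => /andP[at_ tc]; apply: cov.
by rewrite in_itv /= at_ (le_trans tc).
Qed.

Theorem curve_reach p q n (a b : R) (g : R -> 'End(H)) (phi : R -> R) (eps : R) :
    \dim {:H} = n -> curve_joining form p q a b g phi -> 0 < eps ->
    (curve_length form a b g < +oo)%E ->
  reach form p n q ((1 + eps) * (fine (curve_length form a b g) + eps * (b - a))).
Proof.
move=> dimH [ab [s [pas /eqP sb] C1s] cov <- <-] eps0 fin_l.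
have ca : unitary_cover form (g a, phi a) by apply: cov; rewrite in_itv /= lexx ltW.
rewrite -sb in cov fin_l *.
have [_] := pieces_reach dimH ca eps0 pas cov C1s.
by move=> /(_ 0 fin_l (reach_refl dimH ca)); rewrite add0r.
Qed.

End Curves.

(** * Operators diagonal in a fixed orthonormal basis *)

Section Geodesic.
Context {R : realType}.

(** The bound on the derivative is only asked near [x], so that the lemma also
    yields the quadratic remainders below. *)
Lemma mean_value_lipschitz (f f' : R -> R) (K x y : R) :
    (forall z : R, is_derive z 1 f (f' z)) ->
    (forall z, `|z - x| <= `|y - x| -> `|f' z| <= K) ->
  `|f y - f x| <= K * `|y - x|.
Proof.
move=> df fK.
have cf (a b : R) : {within `[a, b], continuous f}.
  apply: derivable_within_continuous => z _; by case: (df z).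
have [xy|yx|->] := ltgtP x y; last by rewrite !subrr normr0 mulr0.
- have [z] := MVT xy (fun z _ => df z) (cf x y).
  rewrite in_itv /= => /andP[xz zy] ->; rewrite normrM ler_wpM2r //.
  by apply: fK; rewrite !gtr0_norm ?subr_gt0 //; lra.
have [z] := MVT yx (fun z _ => df z) (cf y x).
rewrite in_itv /= => /andP[yz zx] E; rewrite distrC E normrM distrC ler_wpM2r //.
by apply: fK; rewrite !ltr0_norm ?subr_lt0 //; lra.
Qed.

Lemma sin_lipschitz (x y : R) : `|sin y - sin x| <= `|y - x|.
Proof.
rewrite -[leRHS]mul1r; apply: (mean_value_lipschitz (f := sin) (f' := cos)) => z _.
exact: cos_max.
Qed.

Lemma cos_lipschitz (x y : R) : `|cos y - cos x| <= `|y - x|.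
Proof.
rewrite -[leRHS]mul1r; apply: (mean_value_lipschitz (f := cos) (f' := fun z => - sin z)) => z _.
by rewrite normrN sin_max.
Qed.

Lemma sin_taylor1 (x y : R) :
  `|sin y - sin x - (y - x) * cos x| <= `|y - x| ^+ 2.
Proof.
pose f z : R := sin z - z * cos x.
have -> : sin y - sin x - (y - x) * cos x = f y - f x by rewrite /f; ring.
have df (z : R) : is_derive z 1 f (cos z - cos x).
  rewrite /f; apply: is_derive_eq.
  by rewrite scaler0 add0r [_%:A]mulr1.
rewrite expr2; apply: (mean_value_lipschitz df) => z h.
exact: le_trans (cos_lipschitz _ _) h.
Qed.

Lemma cos_taylor1 (x y : R) :
  `|cos y - cos x + (y - x) * sin x| <= `|y - x| ^+ 2.
Proof.
pose f z : R := cos z + z * sin x.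
have -> : cos y - cos x + (y - x) * sin x = f y - f x by rewrite /f; ring.
have df (z : R) : is_derive z 1 f (- sin z + sin x).
  rewrite /f; apply: is_derive_eq.
  by rewrite scaler0 add0r [_%:A]mulr1.
rewrite expr2; apply: (mean_value_lipschitz df) => z h.
by rewrite addrC distrC (le_trans (sin_lipschitz _ _) h).
Qed.

Context {H : vectType R[i]} (form : {dot H for conjC}).
Implicit Types (U V : 'End(H)).

Local Notation opnorm := (opnorm form).

Lemma isometry_unitary U :
  (forall x y, form (U x) (U y) = form x y) -> unitary form U.
Proof.
move=> uf; split=> //.
have /lker0P U0 : injective U.
  move=> x y Uxy; apply/eqP; rewrite -subr_eq0 -(dnorm_eq0 form) -uf linearB /=.
  by rewrite Uxy subrr linear0l.
exists (U^-1)%VF => x; first by rewrite lker0_lfunK.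
exact: lker0_lfunVK.
Qed.

Section Diagonal.
Variables (n : nat) (e : 'I_n -> H) (u : 'End(H)).
Hypotheses (dimH : \dim {:H} = n) (oe : orthoframe form e) (uu : unitary form u).

(** [u] followed by the operator with eigenvalues [c i] on the basis [e]. *)
Definition diag_fun (c : 'I_n -> R[i]) (x : H) : H :=
  \sum_i (c i * form (u x) (e i)) *: e i.

Fact diag_fun_linear c : linear (diag_fun c).
Proof.
move=> a x y; rewrite /diag_fun scaler_sumr -big_split /=.
apply: eq_bigr => i _; rewrite linearP /= dotDl dotZl scalerA -scalerDl.
by congr (_ *: _); ring.
Qed.
HB.instance Definition _ c :=
  GRing.isLinear.Build R[i] H H _ (diag_fun c) (diag_fun_linear c).

Definition diag_op c : 'End(H) := linfun (diag_fun c).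

Lemma diag_opE c x : diag_op c x = \sum_i (c i * form (u x) (e i)) *: e i.
Proof. by rewrite lfunE. Qed.

Lemma diag_opB c d : diag_op c - diag_op d = diag_op (fun i => c i - d i).
Proof.
apply/lfunP => x; rewrite add_lfunE opp_lfunE !diag_opE -sumrB.
by apply: eq_bigr => i _; rewrite -scalerBl mulrBl.
Qed.

Lemma diag_opZ a c : a *: diag_op c = diag_op (fun i => a * c i).
Proof.
apply/lfunP => x; rewrite scale_lfunE !diag_opE scaler_sumr.
by apply: eq_bigr => i _; rewrite scalerA mulrA.
Qed.

Lemma diag_op_norm c (M : R) : 0 <= M -> (forall i, sqnc (c i) <= M ^+ 2) ->
  opnorm (diag_op c) <= M.
Proof.
move=> M0 cM; apply: opnorm_le => // x.
rewrite -(ler_pXn2r (n := 2)) ?nnegrE ?mulr_ge0 ?hnorm_ge0 // exprMn.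
rewrite -(unitary_hnorm x uu) -(sum_sqnc (u x) dimH oe) mulr_sumr.
rewrite -(sum_sqnc _ dimH oe); apply: ler_sum => i _.
rewrite diag_opE (frame_comb (fun i => c i * form (u x) (e i))) //.
have -> (a b : R[i]) : sqnc (a * b) = sqnc a * sqnc b.
  by rewrite /sqnc; case: a b => ? ? [? ?]; simpc => /=; ring.
by rewrite ler_wpM2r ?sqnc_ge0.
Qed.

Lemma diag_op_unitary (t : 'I_n -> R) : unitary form (diag_op (fun i => expi (t i))).
Proof.
apply: isometry_unitary => x y; rewrite !diag_opE.
rewrite (frame_form (fun i => _ * _) (fun i => _ * _)) // -uu.2.
rewrite [in RHS](frame_expand (u x) dimH oe) [in RHS](frame_expand (u y) dimH oe).
rewrite (frame_form (form (u x) \o e) (form (u y) \o e)) //=.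
apply: eq_bigr => i _; rewrite rmorphM /= conj_expi mulrACA -expiD subrr expi0.
by rewrite mul1r.
Qed.

Lemma diag_op_eigenframe (t : 'I_n -> R) :
  eigenframe form (diag_op (fun i => expi (t i)) \o u^-1)%VF e t.
Proof.
split=> // i; rewrite comp_lfunE diag_opE /= (unitary_invK _ uu).
rewrite (bigD1 i) //= oe eqxx mulr1 big1 ?addr0 // => j /negbTE ji.
by rewrite oe eq_sym ji mulr0 scale0r.
Qed.

(** The operator is [u] followed by one with eigenvalues [expi (t i)]. *)
Lemma diag_op_det (t : 'I_n -> R) (phi : R) : endo_det u = expi phi ->
  endo_det (diag_op (fun i => expi (t i))) = expi (phi + \sum_i t i).
Proof.
move=> du; have := eigenframe_det dimH (diag_op_eigenframe t).
rewrite addrC expiD -du => <-; rewrite -endo_det_comp; congr endo_det.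
apply/lfunP => x; rewrite !comp_lfunE /=; have [[W UW WU] _] := uu.
have /lker0P U0 : injective u by exact: can_inj UW.
by rewrite lker0_lfunK.
Qed.

End Diagonal.

End Geodesic.

(** * The diagonal geodesic *)

Section GeodesicCurve.
Context {R : realType} {H : vectType R[i]} (form : {dot H for conjC}).
Implicit Types (U V : 'End(H)).

Local Notation opnorm := (opnorm form).
Local Notation mu := (@lebesgue_measure R).

(** Stated for a filter finer than the neighbourhoods of [t], to serve both the
    punctured one of derivatives and the full one of continuity. *)
Lemma lipschitz_cvg0 (G : set_system R) (F : R -> R) (K t : R) :
    Filter G -> G `=>` nbhs t -> 0 <= K ->
    (\forall s \near G, `|F s| <= K * `|s - t|) ->
  F s @[s --> G] --> (0 : R).
Proof.
move=> FG Gt K0 FK; apply/cvgr0Pnorm_lt => e e0.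
have [d d0 dP] : exists2 d : R, 0 < d & K * d < e.
  exists (e / (K + 1)); first by rewrite divr_gt0 ?ltr_wpDl.
  by rewrite mulrA ltr_pdivrMr ?ltr_wpDl //; nra.
have : \forall s \near G, `|s - t| < d.
  apply: Gt; apply/nbhs_ballP; exists d => // s.
  by rewrite /ball /= distrC.
apply: filterS2 FK => s Fs sd; apply: le_lt_trans Fs (le_lt_trans _ dP).
by rewrite ler_wpM2l // ltW.
Qed.

Lemma sqnc_le (c : R[i]) (K : R) :
  `|complex.Re c| <= K -> `|complex.Im c| <= K -> sqnc c <= (2 * K) ^+ 2.
Proof.
rewrite !ler_norml /sqnc => /andP[? ?] /andP[? ?]; nra.
Qed.

Lemma max_abs_ge0 n (t : 'I_n -> R) : 0 <= max_abs t.
Proof. exact: bigmax_ge_id. Qed.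

Lemma le_max_abs n (t : 'I_n -> R) i : `|t i| <= max_abs t.
Proof. exact: le_bigmax. Qed.

Lemma max_abs_le n (t : 'I_n -> R) (M : R) : 0 <= M -> (forall i, `|t i| <= M) ->
  max_abs t <= M.
Proof. by move=> M0 tM; apply: bigmax_le. Qed.

(** Converts a quadratic remainder into a bound on a difference quotient. *)
Lemma quotient_bound (a b h k : R) : h != 0 -> `|a + h * b| <= k * h ^+ 2 ->
  `|h^-1 * a + b| <= k * `|h|.
Proof.
move=> h0 ab; have h1 : 0 < `|h| by rewrite normr_gt0.
rewrite -(ler_pM2l h1) -normrM mulrDr mulVKf // mulrCA -expr2.
by rewrite real_normK ?num_real.
Qed.

Variables (n : nat) (e : 'I_n -> H) (u : 'End(H)) (phi : R) (theta : 'I_n -> R).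
Hypotheses (dimH : \dim {:H} = n) (oe : orthoframe form e).
Hypothesis (cu : unitary_cover form (u, phi)).

Let B := max_abs theta.
Let B0 : 0 <= B := max_abs_ge0 theta.

Definition geodesic (t : R) : 'End(H) :=
  diag_op form e u (fun i => expi (t * theta i)).

Definition geodesic_speed (t : R) : 'End(H) :=
  diag_op form e u (fun i =>
    (- (theta i * sin (t * theta i))) +i* (theta i * cos (t * theta i))).

(** Each coordinate of the difference quotient is off by the second order
    remainder of a cosine and a sine, at most [theta_i ^+ 2 * |s - t|]. *)
Lemma geodesic_derive A t : is_op_derive_within form A geodesic t (geodesic_speed t).
Proof.
apply: (lipschitz_cvg0 (K := 2 * B ^+ 2) (t := t)).
- exact: cvg_trans (cvg_within _) (cvg_within _).
- by rewrite mulr_ge0 ?sqr_ge0.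
rewrite near_withinE; near=> s => _.
have st : s - t != 0 by rewrite subr_eq0; near: s; exact: nbhs_dnbhs_neq.
rewrite ger0_norm ?opnorm_ge0 // /geodesic /geodesic_speed diag_opB diag_opZ diag_opB.
rewrite -mulrA; apply: (diag_op_norm dimH oe cu.1).
  by rewrite !mulr_ge0 ?sqr_ge0.
have thB i : theta i ^+ 2 <= B ^+ 2.
  by rewrite -[_ ^+ 2]real_normK ?num_real // ler_pXn2r ?nnegrE // le_max_abs.
have yx i : s * theta i - t * theta i = (s - t) * theta i by rewrite mulrBl.
move=> i; apply: sqnc_le; rewrite /expi; simpc => /=.
  apply: quotient_bound => //.
  have := cos_taylor1 (t * theta i) (s * theta i).
  rewrite yx -mulrA => /le_trans; apply.
  by rewrite real_normK ?num_real // exprMn mulrC ler_wpM2r ?sqr_ge0.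
apply: quotient_bound => //.
have := sin_taylor1 (t * theta i) (s * theta i).
rewrite yx -mulrA mulrN => /le_trans; apply.
by rewrite real_normK ?num_real // exprMn mulrC ler_wpM2r ?sqr_ge0.
Unshelve. all: by end_near. Qed.

Lemma geodesic_speed_cvg A t :
  opnorm (geodesic_speed s - geodesic_speed t) @[s --> within A (nbhs t)] --> (0 : R).
Proof.
apply: (lipschitz_cvg0 (K := 2 * B ^+ 2) (t := t)).
- exact: cvg_within.
- by rewrite mulr_ge0 ?sqr_ge0.
rewrite near_withinE; near=> s => _.
rewrite ger0_norm ?opnorm_ge0 // /geodesic_speed diag_opB -mulrA.
apply: (diag_op_norm dimH oe cu.1); first by rewrite !mulr_ge0 ?sqr_ge0.
have yx i : `|theta i| * `|s * theta i - t * theta i| <= B ^+ 2 * `|s - t|.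
  rewrite -mulrBl normrM mulrCA mulrC ler_wpM2r // -expr2.
  by rewrite ler_pXn2r ?nnegrE // le_max_abs.
move=> i; apply: sqnc_le; simpc => /=.
  rewrite addrC -mulrBr normrM distrC.
  by apply: le_trans (yx i); rewrite ler_wpM2l // sin_lipschitz.
rewrite -mulrBr normrM.
by apply: le_trans (yx i); rewrite ler_wpM2l // cos_lipschitz.
Unshelve. all: by end_near. Qed.

Lemma geodesic_C1 c d : op_C1 form c d geodesic.
Proof.
by exists geodesic_speed => t _; split;
  [exact: geodesic_derive | exact: geodesic_speed_cvg].
Qed.

Lemma geodesic_speed_norm t : opnorm (geodesic_speed t) <= B.
Proof.
apply: (diag_op_norm dimH oe cu.1) => // i.
have -> : sqnc ((- (theta i * sin (t * theta i))) +i* (theta i * cos (t * theta i)))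
    = theta i ^+ 2.
  by rewrite /sqnc /= sqrrN !exprMn -mulrDr addrC cos2Dsin2 mulr1.
by rewrite -[_ ^+ 2]real_normK ?num_real // ler_pXn2r ?nnegrE // le_max_abs.
Qed.

Lemma geodesic_cover t :
  unitary_cover form (geodesic t, phi + t * \sum_i theta i).
Proof.
split=> /=; first exact: (diag_op_unitary dimH oe cu.1).
by rewrite (diag_op_det dimH oe cu.1 _ cu.2) mulr_sumr.
Qed.

Lemma geodesic0 : geodesic 0 = u.
Proof.
apply/lfunP => y; rewrite diag_opE [RHS](frame_expand _ dimH oe).
by apply: eq_bigr => i _; rewrite mul0r expi0 mul1r.
Qed.

Lemma geodesic1 (w : 'End(H)) : (forall i, w (u^-1%VF (e i)) = expi (theta i) *: e i) ->
  geodesic 1 = w.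
Proof.
move=> we; have [[W UW WU] _] := cu.1.
have /lker0P U0 : injective u by exact: can_inj UW.
apply/lfunP => y; rewrite diag_opE -{2}(lker0_lfunK U0 y).
rewrite {2}(frame_expand (u y) dimH oe) !linear_sum /=.
by apply: eq_bigr => i _; rewrite mul1r !linearZ /= we scalerA mulrC.
Qed.

Lemma affine_C1 (c d a b : R) : real_C1 c d (fun t => a + t * b).
Proof.
exists (fun=> b); split; last first.
  by apply: continuous_subspaceT; exact: cst_continuous.
move=> t _; apply/cvgrPdist_lt => eps eps0.
rewrite near_withinE; near=> s => _.
have st : s - t != 0 by rewrite subr_eq0; near: s; exact: nbhs_dnbhs_neq.
by rewrite opprD addrACA subrr add0r -mulrBl mulKf // subrr normr0.
Unshelve. all: by end_near. Qed.

Lemma geodesic_length : (curve_length form 0 1 geodesic <= B%:E)%E.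
Proof.
apply: (@le_trans _ _ (\int[mu]_(r in `[0%R, 1%R]) (cst B%:E r))%E).
  apply: ge0_le_integral => //=.
  - by move=> r _; rewrite lee_fin opnorm_ge0.
  - apply/measurable_EFinP; exact: piece_measurable (geodesic_C1 0 1).
  - move=> r; rewrite in_itv /= => /andP[r0 r1]; rewrite lee_fin.
    (* The curve extends beyond [0, 1], so the endpoints are interior to a larger
       interval. *)
    rewrite (velocityE (c := -1) (d := 2) _ (geodesic_derive _ _)) ?geodesic_speed_norm //.
    by rewrite (lt_le_trans _ r0) ?ltrN10 // (le_lt_trans r1) // ltr1n.
by rewrite integral_cst //= lebesgue_measure_itv /= lte_fin ltr01 oppr0 adde0 mule1.
Qed.

(** The geodesic determined by [theta] is one of the competing curves. *)
Theorem cover_dist_le (w : 'End(H)) (psi : R) :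
    (forall i, w (u^-1%VF (e i)) = expi (theta i) *: e i) ->
    \sum_i theta i = psi - phi ->
  (cover_dist form (u, phi) (w, psi) <= (max_abs theta)%:E)%E.
Proof.
move=> we st; apply: le_trans geodesic_length; apply: ereal_inf_lbound.
exists 0, 1, geodesic, (fun t => phi + t * \sum_i theta i); split=> //; split.
- exact: ltr01.
- exists [:: 1]; first exact: itv_partition1.
  by case=> // _; split; [exact: geodesic_C1 | exact: affine_C1].
- by move=> t _; apply: geodesic_cover.
- by rewrite geodesic0 mul0r addr0.
- by rewrite (geodesic1 we) mul1r st addrC subrK.
Qed.

End GeodesicCurve.

(** * The minimum and the distance *)

Section Minimum.
Context {R : realType}.

Lemma prod_XsubC_perm n (a b : 'I_n -> R[i]) :
  \prod_i ('X - (a i)%:P) = \prod_i ('X - (b i)%:P) ->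
  exists p : {perm 'I_n}, forall i, a i = b (p i).
Proof.
move=> ab; pose A := [tuple a i | i < n]; pose B := [tuple b i | i < n].
have : perm_eq A B by apply: prod_XsubC_eq; rewrite !big_map.
case/tuple_permP => p Ap; exists p => i.
have := congr1 (fun s : seq _ => nth 0 s i) Ap.
by rewrite -!tnth_nth !tnth_mktuple.
Qed.

(** Two families of arguments differ by integer multiples of [2 pi].  Those that
    improve on [t0] come from integers bounded by [max_abs t0 / pi], so the
    minimum may be sought over a finite set. *)
Lemma arguments_min n (lambda : 'I_n -> R[i]) (x : R) (t0 : 'I_n -> R) :
    arguments lambda x t0 ->
  exists2 t, arguments lambda x t &
    forall t', arguments lambda x t' -> max_abs t <= max_abs t'.
Proof.
move=> t0P; have p0 := @pi_gt0 R; pose M := max_abs t0.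
have M0 : 0 <= M by apply: max_abs_ge0.
have [K MK] : exists K : nat, M < K%:R * pi.
  by exists (Num.truncn (M / pi)).+1; rewrite -ltr_pdivrMr // truncnS_gt.
pose T (f : {ffun 'I_n -> 'I_(K + K).+1}) i : R :=
  t0 i + ((f i)%:R - K%:R) * (2 * pi).
pose P f := `[< arguments lambda x (T f) >].
pose f0 : {ffun 'I_n -> 'I_(K + K).+1} := [ffun=> inord K].
have Tf0 : T f0 = t0.
  apply/funext => i; rewrite /T ffunE inordK ?ltnS ?leq_addr //.
  by rewrite subrr mul0r addr0.
have Pf0 : P f0 by apply/asboolP; rewrite Tf0.
case: (Order.TotalTheory.arg_minP (fun f => max_abs (T f)) Pf0) => f /asboolP Pf fmin.
exists (T f) => // t' t'P.
have [t'M|/ltW Mt'] := leP (max_abs t') M; last first.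
  by apply: le_trans Mt'; rewrite /M -Tf0; apply: fmin.
have /choice[z zP] i : exists z : int, t' i = t0 i + z%:~R * (2 * pi).
  by apply: expi_inj; rewrite t'P.1 t0P.1.
have zK i : `|z i| < K%:Z.
  have h1 : `|t' i| <= M by rewrite (le_trans _ t'M) // le_max_abs.
  have h2 : `|t0 i| <= M by exact: le_max_abs.
  rewrite -(ltr_int R) intr_norm -(ltr_pM2r p0) (le_lt_trans _ MK) //.
  have : `|t' i - t0 i| <= 2 * M.
    by rewrite (le_trans (ler_normB _ _)) // mulr2n mulrDl mul1r lerD.
  rewrite zP addrC addKr normrM (gtr0_norm (mulr_gt0 _ p0)) // mulrCA.
  by rewrite ler_pM2l.
have zK0 i : 0 <= z i + K%:Z.
  by have := zK i; rewrite ltr_norml -lerBlDr sub0r => /andP[/ltW].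
pose f' : {ffun 'I_n -> 'I_(K + K).+1} := [ffun i => inord (absz (z i + K%:Z))].
have Tf' : T f' = t'.
  apply/funext => i; rewrite /T ffunE inordK; last first.
    have /andP[_ ziK] : - K%:Z < z i < K%:Z by rewrite -ltr_norml.
    rewrite -ltz_nat gez0_abs // -addSn PoszD ltrD2r; apply: lt_trans ziK _.
    by rewrite ltz_nat.
  rewrite zP; congr (_ + _ * _).
  by rewrite -[_%:R]/((absz (z i + K%:Z) : int)%:~R) gez0_abs // intrD addrK.
by rewrite -Tf'; apply: fmin; apply/asboolP; rewrite Tf'.
Qed.

Lemma le_of_eps (m L D : R) : 0 <= L -> 0 <= D ->
  (forall eps, 0 < eps -> m <= (1 + eps) * (L + eps * D)) -> m <= L.
Proof.
move=> L0 D0 h; apply/ler_addgt0Pl => e e0.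
pose C := L + 2 * D + 1; have C0 : 0 < C by rewrite /C; lra.
pose eps := Num.min 1 (e / C).
have eps0 : 0 < eps by rewrite lt_min ltr01 divr_gt0.
have eps1 : eps <= 1 by rewrite ge_min lexx.
have epsC : eps * C <= e by rewrite -ler_pdivlMr // ge_min lexx orbT.
have epsD : eps * (eps * D) <= eps * D.
  by rewrite ler_wpM2l ?ler_piMl // ltW.
by apply: le_trans (h _ eps0) _; move: epsC epsD; rewrite /C; lra.
Qed.

End Minimum.

Section Distance.
Context {R : realType} {H : vectType R[i]} (form : {dot H for conjC}).

(** Both products factor the same polynomial, so their roots agree up to order. *)
Lemma eigenframe_arguments n (w : 'End(H)) (e : 'I_n -> H) (s : 'I_n -> R)
    (lambda : 'I_n -> R[i]) :
    \dim {:H} = n -> eigenframe form w e s ->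
    endo_char_poly w = \prod_i ('X - (lambda i)%:P) ->
  exists p : {perm 'I_n}, eigenframe form w (e \o p) (s \o p) /\
    forall i, expi (s (p i)) = lambda i.
Proof.
move=> dimH es E; have := eigenframe_char_poly dimH es; rewrite E.
move=> /prod_XsubC_perm[p pE]; exists p; split=> //.
exact: eigenframe_perm.
Qed.

(** The determinant condition fixes the sum of any choice of arguments modulo
    [2 pi]; correct one of them. *)
Lemma arguments_nonempty n (w : 'End(H)) (lambda : 'I_n -> R[i]) (x : R) :
    \dim {:H} = n -> (0 < n)%N -> unitary_cover form (w, x) ->
    endo_char_poly w = \prod_i ('X - (lambda i)%:P) ->
  exists t, arguments lambda x t.
Proof.
move=> dimH n0 [/= uw dw] E.
have [e [s es]] := unitary_eigenframe uw dimH.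
have [p [ep sp]] := eigenframe_arguments dimH es E.
have := eigenframe_det dimH ep; rewrite dw => /expi_inj[k xk].
pose i0 := Ordinal n0.
exists (fun i => s (p i) + (if i == i0 then k%:~R * (2 * pi) else 0)); split.
  move=> i; rewrite expiD sp; case: eqP => _; last by rewrite expi0 mulr1.
  by rewrite expi_2piM mulr1.
by rewrite big_split /= -big_mkcond big_pred1_eq xk.
Qed.

Lemma reach_arguments n p q (M : R) (lambda : 'I_n -> R[i]) :
    \dim {:H} = n -> 0 <= M -> reach form p n q M ->
    endo_char_poly (q.1 \o p.1^-1)%VF = \prod_i ('X - (lambda i)%:P) ->
  exists2 t, arguments lambda (q.2 - p.2) t & max_abs t <= M.
Proof.
move=> dimH M0 [e [s [es ss sM]]] E.
have [r [er sr]] := eigenframe_arguments dimH es E.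
exists (s \o r); last by apply: max_abs_le => // i; apply: sM.
split=> //; rewrite -ss [RHS](reindex_inj (@perm_inj _ r)) //.
Qed.

End Distance.

Theorem proposition3p3 (R : realType) (H : vectType R[i])
    (form : {dot H for conjC}) (N : nat) (dimH : \dim {:H} = N)
    (N_gt0 : (1 <= N)%N) (u v : 'End(H)) (phi psi : R)
    (u_cover : unitary_cover form (u, phi))
    (v_cover : unitary_cover form (v, psi))
    (lambda : 'I_N -> R[i])
    (lambda_eigen : endo_char_poly (v \o u^-1)%VF
                    = \prod_(i < N) ('X - (lambda i)%:P)) :
  exists2 m : R,
    is_min [set max_abs theta | theta in arguments lambda (psi - phi)] m &
    cover_dist form (u, phi) (v, psi) = m%:E.
Proof.
have w_cover := cover_div u_cover v_cover.
have [t0 t0P] := arguments_nonempty dimH N_gt0 w_cover lambda_eigen.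
have [theta thetaP theta_min] := arguments_min t0P.
exists (max_abs theta).
  by split; [exists theta | move=> _ [t tP <-]; apply: theta_min].
apply/eqP; rewrite eq_le; apply/andP; split.
  have [e [s es]] := unitary_eigenframe w_cover.1 dimH.
  have [p [[oe we] sp]] := eigenframe_arguments dimH es lambda_eigen.
  apply: (cover_dist_le dimH oe u_cover) => [i|]; last exact: thetaP.2.
  by rewrite thetaP.1 -sp -we comp_lfunE.
apply: le_ereal_inf_tmp => _ [a [b [g [f [join ->]]]]].
have [->|fin_l] := eqVneq (curve_length form a b g) +oo%E; first exact: leey.
have l0 : (0 <= curve_length form a b g)%E.
  by apply: integral_ge0 => r _; rewrite lee_fin opnorm_ge0.
have {}fin_l : (curve_length form a b g < +oo)%E by rewrite ltey.
rewrite -[leRHS]fineK ?ge0_fin_numE // lee_fin.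
have ab : 0 <= b - a by case: join => ? *; rewrite subr_ge0 ltW.
apply: (le_of_eps (D := b - a)) => // [|eps eps0]; first exact: fine_ge0.
have [|t tP] := reach_arguments dimH _ (curve_reach dimH join eps0 fin_l) lambda_eigen.
  by rewrite mulr_ge0 ?addr_ge0 ?mulr_ge0 ?fine_ge0 // ltW.
exact/le_trans/theta_min.
Qed.
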